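(* The functions in $\mathcal{S}_{\mathrm R}$ are locally supported, nonnegative on $\Omega$, and form a partition of unity (their sum is identically $1$ on $\Omega$). Moreover, the polynomials $(x,y)\mapsto x$ and $(x,y)\mapsto y$ can be represented on $\Omega$ as $$(x,y) = \sum_{v_i \in V} \sum_{r = 1}^3 q_{i,r}^v B_{i,r}^v(x,y) + \sum_{t_{ijk} \in T_{\mathrm S}} q_{ijk}^t B_{ijk}^t(x,y) + \sum_{e_{ij} \in E} \ \sum_{t_{ijk} \in T_{ij}^e \setminus T_{\mathrm S}} q_{ij,k}^e B_{ij,k}^e(x,y) + \sum_{e_{ij} \in E^b} q_{ij}^e B_{ij}^e(x,y),$$ where $q_{ijk}^t = \tfrac{1}{3} v_i + \tfrac{1}{3} v_j + \tfrac{1}{3} v_k$, $q_{ij,k}^e = \tfrac{1}{3} v_i + \tfrac{1}{3} v_j + \tfrac{1}{3} v_{ijk}$, $q_{ij}^e = \tfrac{1}{3} v_i + \tfrac{1}{3} v_j + \tfrac{1}{3} v_{ij}$.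
   Context: Triangulation. $\Omega\subset\mathbb{R}^2$ is a polygonal domain and $\Delta=(V,E,T)$ is a triangulation of it: $V=\{v_i\}$ is a finite set of vertices (points), $E=\{e_{ij}\}$ a finite set of edges $e_{ij}=[v_i,v_j]$ and $T=\{t_{ijk}\}$ a finite set of nondegenerate triangles $t_{ijk}=[v_i,v_j,v_k]$, where $[\cdot]$ denotes the convex hull. The union of the triangles is $\Omega$, two different triangles intersect in the empty set, an element of $V$ or an element of $E$, and every vertex and edge belongs to at least one triangle. $E^b\subseteq E$ is the set of edges on the boundary of $\Omega$; an edge of $E\setminus E^b$ is shared by two triangles, an edge of $E^b$ belongs to one. Index convention: indices not separated by a comma may be permuted ($a_{ij}=a_{ji}$, $a_{ij,k}=a_{ji,k}$), while the order of comma-separated indices matters. Powell--Sabin refinement. $\Delta_{\mathrm{PS}}=(V_{\mathrm{PS}},E_{\mathrm{PS}},T_{\mathrm{PS}})$ is obtained as follows. A split point $v_{ijk}$ is chosen inside each $t_{ijk}\in T$ so that for every interior edge $e_{ij}$ shared by $t_{ijk},t_{ijk'}\in T$ the segment $[v_{ijk},v_{ijk'}]$ intersects $e_{ij}$ in a point $v_{ij}$ inside $e_{ij}$; for $e_{ij}\in E^b$, $v_{ij}$ is an arbitrary point inside $e_{ij}$. Each $t_{ijk}$ is split into six triangles: $t_{i,j,k}=[v_i,v_{ij},v_{ijk}]$ and the triangles $t_{j,i,k},t_{j,k,i},t_{k,j,i},t_{k,i,j},t_{i,k,j}$ defined by the same rule ($t_{a,b,c}=[v_a,v_{ab},v_{abc}]$).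 These form $T_{\mathrm{PS}}$. Also $e_{i,j}=[v_i,v_{ij}]$, and $E^b_{\mathrm{PS}}$ is the set of all such half-edges $e_{i,j},e_{j,i}$ with $e_{ij}\in E^b$. Blossom. $\mathbb{P}_3$ is the space of bivariate polynomials of total degree at most 3. For $P\in\mathbb{P}_3$, the blossom $\mathcal{B}[P]:(\mathbb{R}^2)^3\to\mathbb{R}$ is the unique symmetric map that is affine in each argument and satisfies $\mathcal{B}[P](p,p,p)=P(p)$. For a spline $S$, $\mathcal{B}[S|_{t}]$ is the blossom of the polynomial coinciding with $S$ on $t$; for a half-edge $e_{i,j}\in E^b_{\mathrm{PS}}$, $\mathcal{B}[S|_{e_{i,j}}](v_i,v_j,v_{ij})$ is the blossom of the polynomial piece on the triangle of $T_{\mathrm{PS}}$ containing $e_{i,j}$. Spline space and its basis. $\mathbb{S}_3^1(\Delta_{\mathrm{PS}})=\{S\in C^1(\Omega): S|_{t}\in\mathbb{P}_3 \text{ for all } t\in T_{\mathrm{PS}}\}$. For each $v_i\in V$ fix a triangle $[q^v_{i,1},q^v_{i,2},q^v_{i,3}]$ (with vertices $q^v_{i,r}$) containing $v_i$, all points $\frac23v_i+\frac13v_{ijk}$ ($t_{ijk}\in T$ with vertex $v_i$) and all points $\frac23v_i+\frac13v_{ij}$ ($e_{ij}\in E$ with endpoint $v_i$). Define the functionals $\beta^v_{i,r}(S)=\mathcal{B}[S|_{t_{i,j,k}}](v_i,v_i,v_i+3(q^v_{i,r}-v_i))$ for $v_i\in V$, $r=1,2,3$ (with any $t_{i,j,k}\in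 T_{\mathrm{PS}}$ having a vertex at $v_i$; independent of the choice); $\beta^t_{i,j,k}(S)=\mathcal{B}[S|_{t_{i,j,k}}](v_i,v_j,v_{ijk})$ for $t_{i,j,k}\in T_{\mathrm{PS}}$; $\beta^e_{i,j}(S)=\mathcal{B}[S|_{e_{i,j}}](v_i,v_j,v_{ij})$ for $e_{i,j}\in E^b_{\mathrm{PS}}$. It is known that these functionals form a basis of the dual space of $\mathbb{S}_3^1(\Delta_{\mathrm{PS}})$; let $B^v_{i,r}$, $B^t_{i,j,k}$, $B^e_{i,j}$ be the corresponding dual basis of $\mathbb{S}_3^1(\Delta_{\mathrm{PS}})$ (each function has value 1 under its own functional and 0 under all the others). It is also known that these dual basis functions are nonnegative on $\Omega$ and locally supported. Symmetric triangles. $T_{\mathrm S}\subseteq T$ is the set of symmetrically refined triangles $t_{ijk}$, i.e. those for which each of the triples $(v_k,v_{ijk},v_{ij})$, $(v_j,v_{ijk},v_{ki})$, $(v_i,v_{ijk},v_{jk})$ is collinear. Combined functions. For $e_{ij}\in E$ and a triangle $t_{ijk}$ attached to $e_{ij}$ put $w_{ij,k}=v_k$ if $t_{ijk}\in T_{\mathrm S}$ and $w_{ij,k}=v_{ijk}$ otherwise. If $e_{ij}\in E\setminus E^b$ is shared by $t_{ijk},t_{ijk'}$, let $\omega_{ij,k},\omega_{ij,k'}\in[0,1]$ satisfy $v_{ijk}=(1-\omega_{ij,k})w_{ij,k}+\omega_{ij,k}w_{ij,k'}$ and $v_{ijk'}=(1-\omega_{ij,k'})w_{ij,k'}+\omega_{ij,k'}w_{ij,k}$,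 and set $B^e_{ij,k}=(1-\omega_{ij,k})(B^t_{i,j,k}+B^t_{j,i,k})+\omega_{ij,k'}(B^t_{i,j,k'}+B^t_{j,i,k'})$ (and $B^e_{ij,k'}$ by exchanging $k$ and $k'$). If $e_{ij}\in E^b$ belongs to $t_{ijk}$, let $\omega_{ij,k}\in[0,1]$ satisfy $v_{ijk}=(1-\omega_{ij,k})w_{ij,k}+\omega_{ij,k}v_{ij}$, and set $B^e_{ij,k}=(1-\omega_{ij,k})(B^t_{i,j,k}+B^t_{j,i,k})$ and $B^e_{ij}=(B^e_{i,j}+B^e_{j,i})+\omega_{ij,k}(B^t_{i,j,k}+B^t_{j,i,k})$. For $t_{ijk}\in T_{\mathrm S}$ set $B^t_{ijk}=B^e_{ij,k}+B^e_{jk,i}+B^e_{ki,j}$. Reduced set. Let $T^e_{ij}\subseteq T$ be the set of triangles attached to $e_{ij}$. The set $\mathcal{S}_{\mathrm R}$ consists of: $B^v_{i,r}$ for $v_i\in V$, $r\in\{1,2,3\}$; $B^t_{ijk}$ for $t_{ijk}\in T_{\mathrm S}$; $B^e_{ij,k}$ for $e_{ij}\in E$ and $t_{ijk}\in T^e_{ij}\setminus T_{\mathrm S}$; $B^e_{ij}$ for $e_{ij}\in E^b$. Local support means here: $B^v_{i,r}$ is zero on every triangle of $\Delta$ without a vertex at $v_i$; $B^e_{ij,k}$ and $B^e_{ij}$ are zero on every triangle of $\Delta$ not attached to $e_{ij}$; $B^t_{ijk}$ is zero on every triangle of $\Delta$ other than $t_{ijk}$ and the triangles sharing an edge with $t_{ijk}$.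 *)

(* Defs.v *)
From HB Require Import structures.
From mathcomp Require Export all_boot all_order all_algebra.
From mathcomp Require Export all_classical all_reals.
From mathcomp Require Export topology normedtype derive.

Set Implicit Arguments.
Unset Strict Implicit.
Unset Printing Implicit Defensive.

Import Order.TTheory GRing.Theory Num.Theory.
Import numFieldNormedType.Exports.

Local Open Scope ring_scope.

Notation point R := 'rV[R]_2 (only parsing).

Section Plane.
Context {R : realType}.
Implicit Types (s : seq (point R)) (A : set (point R)) (P S : point R -> R).

Definition hull s : set (point R) :=
  [set p | exists a : nat -> R,
     [/\ forall k, 0 <= a k, \sum_(k < size s) a k = 1 &
         p = \sum_(k < size s) a k *: s`_k]]%classic.

(* Being (strictly) inside a triangle or an edge: for affinely independent [s]
   this is the relative interior of [hull s]. *)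
Definition inside s : set (point R) :=
  [set p | exists a : nat -> R,
     [/\ forall k, 0 < a k, \sum_(k < size s) a k = 1 &
         p = \sum_(k < size s) a k *: s`_k]]%classic.

Definition collinear (a b c : point R) : Prop :=
  exists (o d : point R) (x y z : R),
    [/\ a = o + x *: d, b = o + y *: d & c = o + z *: d].

Definition boundary A : set (point R) := (closure A `\` interior A)%classic.

(* C^1 up to the boundary: in the interior of [A] all directional derivatives
   exist, and they extend, like [S] itself, continuously to [A]. *)
Definition C1_on A S : Prop :=
  ({within A, continuous S})%classic /\
  forall v : point R, exists2 g : point R -> R,
    ({within A, continuous g})%classic &
    forall p, interior A p -> is_derive p v (S : point R -> R^o) (g p).

Definition cubic P : Prop :=
  exists c : 'I_4 -> 'I_4 -> R, forall p : point R,
    P p = \sum_(i < 4) \sum_(j < 4 | (i + j <= 3)%N)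
            c i j * p 0 0 ^+ i * p 0 1 ^+ j.

Definition affine_fun (f : point R -> R) : Prop :=
  forall (p q : point R) (x : R),
    f ((1 - x) *: p + x *: q) = (1 - x) * f p + x * f q.

Definition is_blossom P (b : point R -> point R -> point R -> R) : Prop :=
  [/\ forall p q r, b p q r = b q p r,
      forall p q r, b p q r = b p r q,
      forall p q, affine_fun (b p q) &
      forall p, b p p p = P p].

(* The unique map satisfying [is_blossom P], for [P] cubic. *)
Definition blossom P : point R -> point R -> point R -> R :=
  xget (fun _ _ _ => 0) [set b | is_blossom P b]%classic.

(* The cubic polynomial coinciding with [S] on [A]; it is unique as soon as [A]
   has interior points. *)
Definition piece S A : point R -> R :=
  xget (fun=> 0) [set P | cubic P /\ forall p, A p -> S p = P p]%classic.

End Plane.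

Section Triangulation.
Context {R : realType} {V : finType}.

(* Vertices are indexed by [V]; the edge e_ij is the index set {i, j} and the
   triangle t_ijk is the index set {i, j, k}. *)
Record mesh := Mesh {
  vtx : V -> point R;
  edges : {set {set V}};
  tris : {set {set V}} }.

Implicit Types (D : mesh) (e t : {set V}).

Definition cell D e : set (point R) := hull [seq vtx D i | i in e].

Definition Omega D : set (point R) :=
  [set p | exists2 t, t \in tris D & cell D t p]%classic.

Definition bedges D : {set {set V}} :=
  [set e in edges D | `[< (cell D e `<=` boundary (Omega D))%classic >]].

Definition tris_at D e : {set {set V}} := [set t in tris D | e \subset t].

Record is_triangulation D : Prop := IsTriangulation {
  vtx_inj : injective (vtx D);
  card_edge : forall e, e \in edges D -> #|e| = 2%N;
  card_tri : forall t, t \in tris D -> #|t| = 3%N;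
  nondegenerate : forall i j k, [set i; j; k] \in tris D ->
    ~ collinear (vtx D i) (vtx D j) (vtx D k);
  edge_of_tri : forall e t, t \in tris D -> e \subset t -> #|e| = 2%N ->
    e \in edges D;
  tris_meet : forall t t', t \in tris D -> t' \in tris D -> t != t' ->
    [\/ (cell D t `&` cell D t' = set0)%classic,
        exists i, (cell D t `&` cell D t' = [set vtx D i])%classic |
        exists2 e, e \in edges D & (cell D t `&` cell D t' = cell D e)%classic];
  vtx_covered : forall i, exists2 t, t \in tris D & i \in t;
  edge_covered : forall e, e \in edges D -> exists2 t, t \in tris D & e \subset t;
  interior_edge : forall e, e \in edges D -> e \notin bedges D ->
    #|tris_at D e| = 2%N;
  boundary_edge : forall e, e \in bedges D -> #|tris_at D e| = 1%N }.

(* Split points v_ijk = [tpt t] of the triangles and v_ij = [ept e] of the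
   edges; the values at other index sets are irrelevant. *)
Record split := Split {
  tpt : {set V} -> point R;
  ept : {set V} -> point R }.

Implicit Type Q : split.

Record is_PS D Q : Prop := IsPS {
  tpt_inside : forall t, t \in tris D ->
    inside [seq vtx D i | i in t] (tpt Q t);
  ept_inside : forall e, e \in edges D ->
    inside [seq vtx D i | i in e] (ept Q e);
  ept_meet : forall e t t', e \in edges D -> e \notin bedges D ->
    t \in tris_at D e -> t' \in tris_at D e -> t != t' ->
    (hull [:: tpt Q t; tpt Q t'] `&` cell D e = [set ept Q e])%classic }.

(* The triangle t_{i,j,k} of the refinement is indexed by (i, j, t) with
   t = {i, j, k}. *)
Definition is_micro D (i j : V) t : bool :=
  (i != j) && (t \in tris_at D [set i; j]).

Definition micro D Q (i j : V) t : set (point R) :=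
  hull [:: vtx D i; ept Q [set i; j]; tpt Q t].

Definition spline D Q (S : point R -> R) : Prop :=
  C1_on (Omega D) S /\
  forall i j t, is_micro D i j t ->
    exists2 P, cubic P & forall p, micro D Q i j t p -> S p = P p.

Definition micro_blossom D Q (S : point R -> R) (i j : V) t :=
  blossom (piece S (micro D Q i j t)).

(* Degrees of freedom: [Dv i r], [Dt i j t], [De i j] index beta^v_{i,r},
   beta^t_{i,j,k} with t = {i, j, k}, and beta^e_{i,j}. *)
Inductive dof :=
  | Dv of V & 'I_3
  | Dt of V & V & {set V}
  | De of V & V.

Definition is_dof D (a : dof) : bool :=
  match a with
  | Dv _ _ => true
  | Dt i j t => is_micro D i j t
  | De i j => [set i; j] \in bedges D
  end.

(* [pick] selects some small triangle at v_i (resp. the one containing the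
   boundary half-edge e_{i,j}). *)
Definition beta D Q (q : V -> 'I_3 -> point R) (a : dof) (S : point R -> R) : R :=
  match a with
  | Dv i r =>
      if [pick x : V * {set V} | is_micro D i x.1 x.2] is Some (j, t) then
        micro_blossom D Q S i j t
          (vtx D i) (vtx D i) (vtx D i + 3 *: (q i r - vtx D i))
      else 0
  | Dt i j t => micro_blossom D Q S i j t (vtx D i) (vtx D j) (tpt Q t)
  | De i j =>
      if [pick t in tris_at D [set i; j]] is Some t then
        micro_blossom D Q S i j t (vtx D i) (vtx D j) (ept Q [set i; j])
      else 0
  end.

Definition is_vertex_triangle D Q (i : V) (q : 'I_3 -> point R) : Prop :=
  let tri := hull [:: q 0; q 1; q 2] in
  [/\ ~ collinear (q 0) (q 1) (q 2),
      tri (vtx D i),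
      forall t, t \in tris D -> i \in t ->
        tri ((2 / 3) *: vtx D i + (1 / 3) *: tpt Q t) &
      forall e, e \in edges D -> i \in e ->
        tri ((2 / 3) *: vtx D i + (1 / 3) *: ept Q e)].

(* As the functionals [beta] form a basis of the dual of the spline space, these
   conditions determine [B] on [Omega]. *)
Definition is_dual_basis D Q q (B : dof -> point R -> R) : Prop :=
  [/\ forall a, is_dof D a -> spline D Q (B a),
      forall a, is_dof D a -> beta D Q q a (B a) = 1 &
      forall a b, is_dof D a -> is_dof D b -> a <> b ->
        beta D Q q a (B b) = 0].

Definition sym_tris D Q : {set {set V}} :=
  [set t in tris D |
    `[< forall k, k \in t -> collinear (vtx D k) (tpt Q t) (ept Q (t :\ k)) >]].

Definition wpt D Q (k : V) t : point R :=
  if t \in sym_tris D Q then vtx D k else tpt Q t.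

(* omega_{ij,k} is [om {i, j} {i, j, k}]. *)
Definition is_weights D Q (om : {set V} -> {set V} -> R) : Prop :=
  (forall i j k k',
     let e := [set i; j] in let t := k |: e in let t' := k' |: e in
     e \in edges D -> e \notin bedges D ->
     t \in tris D -> t' \in tris D -> t != t' ->
     0 <= om e t <= 1 /\
     tpt Q t = (1 - om e t) *: wpt D Q k t + om e t *: wpt D Q k' t') /\
  (forall i j k,
     let e := [set i; j] in let t := k |: e in
     e \in bedges D -> t \in tris D ->
     0 <= om e t <= 1 /\
     tpt Q t = (1 - om e t) *: wpt D Q k t + om e t *: ept Q e).

Section Reduced.
Variables (D : mesh) (Q : split) (B : dof -> point R -> R).
Variable om : {set V} -> {set V} -> R.
Implicit Type p : point R.

(* B^t_{i,j,k} + B^t_{j,i,k} for e = {i, j}, t = {i, j, k}: the sum runs over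
   the two ordered pairs spanning e. *)
Definition BtE e t p : R :=
  \sum_(x : V * V | [set x.1; x.2] == e) B (Dt x.1 x.2 t) p.

Definition Bv (i : V) (r : 'I_3) p : R := B (Dv i r) p.

(* B^e_{ij,k}: the last sum consists of the term of the other triangle attached
   to e, and is empty for a boundary edge. *)
Definition Bek e t p : R :=
  (1 - om e t) * BtE e t p +
  \sum_(t' in tris_at D e | t' != t) om e t' * BtE e t' p.

(* B^e_ij, for e in [bedges D]: exactly one triangle is attached to e. *)
Definition Beb e p : R :=
  \sum_(x : V * V | [set x.1; x.2] == e) B (De x.1 x.2) p +
  \sum_(t in tris_at D e) om e t * BtE e t p.

Definition Bt3 t p : R :=
  \sum_(e in edges D | e \subset t) Bek e t p.

End Reduced.

Definition qt3 D t : point R := \sum_(i in t) (1 / 3) *: vtx D i.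

Definition qek D Q e t : point R :=
  \sum_(i in e) (1 / 3) *: vtx D i + (1 / 3) *: tpt Q t.

Definition qeb D Q e : point R :=
  \sum_(i in e) (1 / 3) *: vtx D i + (1 / 3) *: ept Q e.

End Triangulation.

Arguments mesh : clear implicits.
Arguments split : clear implicits.
Arguments dof : clear implicits.

(* Main.v *)
Require Import Defs.
From mathcomp Require Import finset ring lra.
Import Order.TTheory GRing.Theory Num.Theory.
Import numFieldNormedType.Exports.
Set Implicit Arguments.
Unset Strict Implicit.
Unset Printing Implicit Defensive.
Local Open Scope ring_scope.

(* By C^1 smoothness the gradients of all polynomial pieces of a spline agree at
   a common point, hence for pieces sharing the segment [p, q] the blossoms agree
   at (p, q, x) for every x in the plane. Consequently each Bernstein coefficient
   of a spline on a small triangle is a combination, with nonnegative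
   coefficients depending only on the geometry, of the functionals beta attached
   to the vertices and edges of the surrounding triangle of the mesh. So a spline
   is nonnegative (resp. zero) on a triangle as soon as its local functionals
   are, which yields nonnegativity and local support of the dual basis, and the
   expansion of every affine function f as the sum of f(xi_a) B_a, xi_a being the
   Greville point of the functional beta_a. Grouping the terms according to the
   weights omega, for f equal to 1, x and y, gives the claim. *)

(** * Blossoms of cubic polynomials *)

Section Blossoms.
Context {R : realType}.
Implicit Types (p v a m c : 'rV[R]_2) (f : 'rV[R]_2 -> R).
Implicit Types (P S : 'rV[R]_2 -> R).
Implicit Types (b : 'rV[R]_2 -> 'rV[R]_2 -> 'rV[R]_2 -> R).

Lemma rv2_eq p v : p 0 0 = v 0 0 -> p 0 1 = v 0 1 -> p = v.
Proof.
move=> e0 e1; apply/rowP => -[[|[|//]] lt_i].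
  by rewrite (_ : Ordinal lt_i = 0) //; apply/val_inj.
by rewrite (_ : Ordinal lt_i = 1) //; apply/val_inj.
Qed.

Lemma affine_funD f p v : affine_fun f -> f (p + v) = f p + f v - f 0.
Proof.
move=> fA.
(* The point [p + v] is twice the midpoint of [p] and [v], so it lies on the line from 0 through
   that midpoint, at parameter 2. *)
have f2 : f (2 *: ((1 - 1 / 2) *: p + (1 / 2) *: v)) = - f 0 + (f p + f v).
  have := fA 0 ((1 - 1 / 2) *: p + (1 / 2) *: v) 2.
  by rewrite scaler0 add0r fA => ->; lra.
rewrite -[f p + f v - f 0]addrC -f2; congr f.
by apply: rv2_eq; rewrite !mxE; lra.
Qed.

Lemma affine_funZ f p (x : R) : affine_fun f -> f (x *: p) = (1 - x) * f 0 + x * f p.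
Proof. by move=> /(_ 0 p x); rewrite scaler0 add0r. Qed.

Lemma affine_fun3 f a m c (x y z : R) : affine_fun f -> x + y + z = 1 ->
  f (x *: a + y *: m + z *: c) = x * f a + y * f m + z * f c.
Proof.
move=> fA s1; rewrite !(affine_funD _ _ fA) !(affine_funZ _ _ fA).
by rewrite (_ : z = 1 - x - y); [ring | lra].
Qed.

(* Polarization. All points at which P is evaluated lie in the convex hull of
   x, y, z, so the values of a cubic on a triangle determine its blossom at the
   corners. *)
Definition polar P (x y z : 'rV[R]_2) : R :=
  (27 * P (3^-1 *: (x + y + z))
   - 8 * (P (2^-1 *: (x + y)) + P (2^-1 *: (x + z)) + P (2^-1 *: (y + z)))
   + (P x + P y + P z)) / 6.

Section IsBlossom.
Context {P : 'rV[R]_2 -> R} {b : 'rV[R]_2 -> 'rV[R]_2 -> 'rV[R]_2 -> R}.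
Hypothesis bP : is_blossom P b.

Let b12 x y z : b x y z = b y x z. Proof. by case: bP. Qed.
Let b23 x y z : b x y z = b x z y. Proof. by case: bP. Qed.

Lemma blossom_diag p : b p p p = P p. Proof. by case: bP. Qed.
Lemma blossom_affine x y : affine_fun (b x y). Proof. by case: bP. Qed.

Lemma blossom_bary a m c x y (u v w : R) : u + v + w = 1 ->
  b x y (u *: a + v *: m + w *: c) = u * b x y a + v * b x y m + w * b x y c.
Proof. exact/affine_fun3/blossom_affine. Qed.

Lemma blossom_seg a m x y (u : R) :
  b x y ((1 - u) *: a + u *: m) = (1 - u) * b x y a + u * b x y m.
Proof. exact: blossom_affine. Qed.

(** Expanding [P] at the midpoints and the centroid by multi-affinity leaves, in this combination,
    only the mixed value. Hence a blossom is unique. *)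
Lemma blossomE x y z : b x y z = polar P x y z.
Proof.
have b3 p q : b p q (3^-1 *: (x + y + z)) = (b p q x + b p q y + b p q z) / 3.
  by rewrite !scalerDr blossom_bary; lra.
have b2 p q u v : b p q (2^-1 *: (u + v)) = (b p q u + b p q v) / 2.
  rewrite scalerDr (_ : 2^-1 *: u = (1 - 2^-1) *: u) ?blossom_seg; first by field.
  by congr (_ *: _); field.
have b3' p q : b p (3^-1 *: (x + y + z)) q = (b p x q + b p y q + b p z q) / 3.
  by rewrite b23 b3 !(b23 p _ q).
have b2' p q u v : b p (2^-1 *: (u + v)) q = (b p u q + b p v q) / 2.
  by rewrite b23 b2 !(b23 p _ q).
have two u v : 8 * P (2^-1 *: (u + v)) =
    b u u u + 3 * b u u v + 3 * b u v v + b v v v.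
  rewrite -blossom_diag b2 !b2' !(b12 (2^-1 *: _)) !b2'.
  by rewrite (b12 v u u) (b23 u v u) (b23 v v u) (b12 v u v); field.
rewrite /polar !mulrDr !two -!blossom_diag b3 !b3' !(b12 (3^-1 *: _)) !b3'.
(* Symmetry brings all argument triples to one fixed order, so that [field] identifies equal
   terms. *)
rewrite (b12 y x x) (b23 x y x) (b12 z x x) (b23 x z x) (b23 y y x) (b12 y x y).
rewrite (b23 z z x) (b12 z x z) (b12 z y y) (b23 y z y) (b23 z z y) (b12 z y z).
rewrite (b23 z y x) (b12 z x y) (b23 x z y) (b23 y z x) (b12 y x z).
by field.
Qed.

(** Bernstein form of [P] along a line. The parameter is unrestricted, so that difference quotients
    can be computed from it. *)
Lemma blossom_curve p q (s : R) :
  P ((1 - s) *: p + s *: q) = (1 - s) ^+ 3 * b p p p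
    + 3 * (1 - s) ^+ 2 * s * b p p q + 3 * (1 - s) * s ^+ 2 * b p q q
    + s ^+ 3 * b q q q.
Proof.
set r := _ + _; have br x y : b x y r = (1 - s) * b x y p + s * b x y q.
  exact: blossom_seg.
have br' x y : b x r y = (1 - s) * b x p y + s * b x q y by rewrite b23 br !(b23 x y).
rewrite -blossom_diag br !br' !(b12 r) !br' (b12 q p p) (b23 p q p) (b23 q q p).
by rewrite (b12 q p q); ring.
Qed.

Lemma blossom_curve2 p q x (s : R) (r := (1 - s) *: p + s *: q) :
  b r r x = (1 - s) ^+ 2 * b p p x + 2 * (1 - s) * s * b p q x
    + s ^+ 2 * b q q x.
Proof.
have br' y z : b y r z = (1 - s) * b y p z + s * b y q z.
  by rewrite b23 (blossom_seg p q) !(b23 y z).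
by rewrite br' !(b12 r) !br' (b12 q p); ring.
Qed.

End IsBlossom.

(** Polarization is linear in [P], which reduces the claim to monomials. *)
Lemma polar_affine P : cubic P -> forall x y, affine_fun (polar P x y).
Proof.
case=> c Pc x y.
pose mono (i j : 'I_4) p := p 0 0 ^+ i * p 0 1 ^+ j.
have polarE z : polar P x y z =
    \sum_(i < 4) \sum_(j < 4 | (i + j <= 3)%N) c i j * polar (mono i j) x y z.
  have PE p : P p = \sum_(i < 4) \sum_(j < 4 | (i + j <= 3)%N) c i j * mono i j p.
    by rewrite Pc; apply: eq_bigr => i _; apply: eq_bigr => j _; rewrite mulrA.
  rewrite /polar !PE.
  rewrite -!big_split /= !mulr_sumr -sumrB -big_split /= mulr_suml.
  apply: eq_bigr => i _.
  rewrite -!big_split /= !mulr_sumr -sumrB -big_split /= mulr_suml.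
  by apply: eq_bigr => j _; ring.
move=> p q t; rewrite !polarE !mulr_sumr -big_split; apply: eq_bigr => i _.
rewrite /= !mulr_sumr -big_split; apply: eq_bigr => j ij /=.
suff -> : polar (mono i j) x y ((1 - t) *: p + t *: q) =
    (1 - t) * polar (mono i j) x y p + t * polar (mono i j) x y q by ring.
rewrite /polar /mono !mxE.
(* The ten monomials of degree at most 3 are checked one by one. *)
by case: i j ij => [[|[|[|[|//]]]] ?] [[|[|[|[|//]]]] ?] //= _; field.
Qed.

Lemma polar_blossom P : cubic P -> is_blossom P (polar P).
Proof.
move=> Pc; split; last 2 first.
- exact: polar_affine.
- move=> p; have three : 3^-1 *: (p + p + p) = p.
    by apply: rv2_eq; rewrite !mxE; field.
  have two : 2^-1 *: (p + p) = p by apply: rv2_eq; rewrite !mxE; field.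
  by rewrite /polar three two; field.
- by move=> x y z; rewrite /polar (addrC y x); ring.
- by move=> x y z; rewrite /polar (addrAC x z y) (addrC z y); ring.
Qed.

(** Existence and uniqueness together replace the choice in [blossom] by an explicit formula. *)
Lemma blossom_polar P : cubic P -> blossom P = polar P.
Proof.
move=> Pc; apply: xget_unique; first exact: polar_blossom.
by move=> b bP; do 3!apply/funext => ?; exact: blossomE.
Qed.

End Blossoms.

(** * Triangles and gradients *)

Section Triangles.
Local Open Scope classical_set_scope.
Context {R : realType}.
Implicit Types (p v a m c : 'rV[R]_2) (f : 'rV[R]_2 -> R).
Implicit Types (P S : 'rV[R]_2 -> R).
Implicit Types (b : 'rV[R]_2 -> 'rV[R]_2 -> 'rV[R]_2 -> R).

(** Twice the signed area of the triangle. *)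
Definition det3 a m c : R :=
  (m 0 0 - a 0 0) * (c 0 1 - a 0 1) - (m 0 1 - a 0 1) * (c 0 0 - a 0 0).

Lemma det3_neq0 a m c : ~ collinear a m c -> det3 a m c != 0.
Proof.
move=> ncol; apply/eqP => d0; apply: ncol.
have [eq_ma|ne_ma] := eqVneq m a.
  exists a, (c - a), 0, 0, 1; rewrite eq_ma scale0r addr0 scale1r.
  by split=> //; rewrite addrC subrK.
have [x0|x0] := eqVneq (m 0 0 - a 0 0) 0; last first.
  exists a, (m - a), 0, 1, ((c 0 0 - a 0 0) / (m 0 0 - a 0 0)).
  rewrite scale0r addr0 scale1r addrC subrK; split=> //.
  apply: rv2_eq; rewrite !mxE; first by field.
  apply: (mulfI x0); rewrite mulrDr mulrA mulrCA mulfV // mulr1.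
  by apply/eqP; rewrite -subr_eq0 -[X in _ == X]d0; apply/eqP; rewrite /det3; ring.
have [y0|y0] := eqVneq (m 0 1 - a 0 1) 0.
  case/eqP: ne_ma; apply: rv2_eq; apply/eqP; rewrite -subr_eq0; exact/eqP.
exists a, (m - a), 0, 1, ((c 0 1 - a 0 1) / (m 0 1 - a 0 1)).
rewrite scale0r addr0 scale1r addrC subrK; split=> //.
apply: rv2_eq; rewrite !mxE; last by field.
apply: (mulfI y0); rewrite mulrDr mulrA mulrCA mulfV // mulr1.
by apply/eqP; rewrite -subr_eq0 -[X in _ == X]oppr0 -d0; apply/eqP; rewrite /det3; ring.
Qed.

(** Cramer's rule: the barycentric coordinates of any point of the plane are ratios of signed
    areas. *)
Lemma barycentric a m c p (d := det3 a m c) : d != 0 ->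
  p = (det3 p m c / d) *: a + (det3 a p c / d) *: m + (det3 a m p / d) *: c
  /\ det3 p m c / d + det3 a p c / d + det3 a m p / d = 1.
Proof.
rewrite /d /det3 => d0.
by split; [apply: rv2_eq; rewrite !mxE; field | field].
Qed.

Lemma hull2P a m p : hull [:: a; m] p <->
  exists x y : R, [/\ 0 <= x, 0 <= y, x + y = 1 & p = x *: a + y *: m].
Proof.
split=> [[w []]|[x [y [x0 y0 s1 pE]]]].
  rewrite !big_ord_recl !big_ord0 /= !addr0 => w0 w1 ->.
  by exists (w 0%N), (w 1%N).
(* [hull] asks for nonnegative weights at every natural index; past the end of the list [nth]
   returns 0. *)
exists (fun k => [:: x; y]`_k); rewrite !big_ord_recl !big_ord0 /= !addr0; split=> //.
by move=> [|[|k]] //=; rewrite nth_nil.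
Qed.

Lemma hull3P a m c p : hull [:: a; m; c] p <->
  exists x y z : R, [/\ 0 <= x, 0 <= y, 0 <= z, x + y + z = 1 &
    p = x *: a + y *: m + z *: c].
Proof.
split=> [[w []]|[x [y [z [x0 y0 z0 s1 pE]]]]].
  rewrite !big_ord_recl !big_ord0 /= !addr0 !addrA => w0 w1 ->.
  by exists (w 0%N), (w 1%N), (w 2%N).
exists (fun k => [:: x; y; z]`_k).
rewrite !big_ord_recl !big_ord0 /= !addr0 !addrA; split=> //.
by move=> [|[|[|k]]] //=; rewrite nth_nil.
Qed.

Lemma hull3_corners a m c :
  [/\ hull [:: a; m; c] a, hull [:: a; m; c] m & hull [:: a; m; c] c].
Proof.
split; apply/hull3P.
- exists 1, 0, 0; split; rewrite ?scale0r ?scale1r ?addr0 //; lra.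
- exists 0, 1, 0; split; rewrite ?scale0r ?scale1r ?addr0 ?add0r //; lra.
- exists 0, 0, 1; split; rewrite ?scale0r ?scale1r ?add0r //; lra.
Qed.

Lemma coord_affine_continuous (k0 k1 k2 : R) :
  continuous (fun p : 'rV[R]_2 => k0 + k1 * p 0 0 + k2 * p 0 1).
Proof.
move=> p; have h i := @coord_continuous R 1 2 0 i p.
exact: (cvgD (cvgD (cvg_cst _) (@cvgMl_tmp R _ _ _ _ k1 _ (h 0)))
  (@cvgMl_tmp R _ _ _ _ k2 _ (h 1))).
Qed.

Lemma det3_continuous a m c :
  [/\ continuous (fun p => det3 p m c), continuous (fun p => det3 a p c) &
      continuous (fun p => det3 a m p)].
Proof.
split.
- rewrite (_ : (fun _ => _) = fun p => (m 0 0 * c 0 1 - m 0 1 * c 0 0)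
    + (m 0 1 - c 0 1) * p 0 0 + (c 0 0 - m 0 0) * p 0 1).
    exact: coord_affine_continuous.
  by apply/funext => p; rewrite /det3; ring.
- rewrite (_ : (fun _ => _) = fun p => (a 0 1 * c 0 0 - a 0 0 * c 0 1)
    + (c 0 1 - a 0 1) * p 0 0 + (a 0 0 - c 0 0) * p 0 1).
    exact: coord_affine_continuous.
  by apply/funext => p; rewrite /det3; ring.
- rewrite (_ : (fun _ => _) = fun p => (a 0 0 * m 0 1 - a 0 1 * m 0 0)
    + (a 0 1 - m 0 1) * p 0 0 + (m 0 0 - a 0 0) * p 0 1).
    exact: coord_affine_continuous.
  by apply/funext => p; rewrite /det3; ring.
Qed.

(** Barycentric coordinates are continuous, so if they are positive at a point they stay positive
    nearby. *)
Lemma nbhs_hull3 a m c (x y z : R) : det3 a m c != 0 ->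
  0 < x -> 0 < y -> 0 < z -> x + y + z = 1 ->
  nbhs (x *: a + y *: m + z *: c) (hull [:: a; m; c]).
Proof.
move=> d0 x0 y0 z0 s1; set p := _ + _.
have [c1 c2 c3] := det3_continuous a m c.
have E : [/\ det3 p m c / det3 a m c = x, det3 a p c / det3 a m c = y &
  det3 a m p / det3 a m c = z].
  have -> : z = 1 - x - y by lra.
  by move: d0; rewrite /p (_ : z = 1 - x - y) /det3 ?mxE; [|lra] => d0; split; field.
have [E1 E2 E3] := E.
have near_pos f : continuous f -> 0 < f p / det3 a m c ->
    \forall u \near p, 0 < f u / det3 a m c.
  move=> cf f0; have : (fun u => f u / det3 a m c) @ p --> f p / det3 a m c.
    exact: (cvgM (cf p) (cvg_cst _)).
  by move/cvgr_gt => /(_ _ f0).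
have n1 := near_pos _ c1; have n2 := near_pos _ c2; have n3 := near_pos _ c3.
rewrite E1 in n1; rewrite E2 in n2; rewrite E3 in n3.
near=> u; apply/hull3P; have [uE u1] := barycentric u d0.
do 3!eexists; split; [| | | exact: u1 | exact: uE]; apply/ltW.
- by near: u; exact: n1.
- by near: u; exact: n2.
- by near: u; exact: n3.
Unshelve. all: by end_near. Qed.

Lemma horner_cvg0 (q : {poly R}) (u : R -> R) (F : set_system R) :
  F --> (0 : R) -> (\forall h \near F, u h = q.[h]) -> Filter F ->
  u @ F --> q.[0].
Proof.
move=> F0 uq FF.
have cq : (fun h => q.[h]) @ F --> q.[0].
  have c0 := @continuous_horner R q 0.
  by apply: cvg_trans c0; exact: cvg_app.
apply: cvg_trans cq; apply: near_eq_cvg.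
by apply: filterS uq => h ->.
Qed.

(** [b p p v - b p p 0] is the linear part of the affine map [b p p], applied to the vector [v]. *)
Lemma blossom_is_derive P b p v : is_blossom P b ->
  is_derive p v (P : 'rV[R]_2 -> R^o) (3 * (b p p v - b p p 0)).
Proof.
move=> bP.
have dE : 3 * (b p p v - b p p 0) = 3 * (b p p (p + v) - b p p p).
  by rewrite (affine_funD _ _ (blossom_affine bP p p)); ring.
(* The difference quotient as a polynomial in the increment, read off from the Bernstein form on the
   line through [p] and [p + v]. *)
pose q : {poly R} := (3 * (b p p (p + v) - b p p p))%:P
  + (3 * (b p p p - 2 * b p p (p + v) + b p (p + v) (p + v)))%:P * 'X
  + (b (p + v) (p + v) (p + v) - b p p p + 3 * b p p (p + v)
     - 3 * b p (p + v) (p + v))%:P * 'X^2.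
have lim0 : (fun h : R => h^-1 *: (((P : 'rV[R]_2 -> R^o) \o shift p) (h *: v) - P p))
    @ 0^' --> (3 * (b p p v - b p p 0) : R^o).
  have -> : (3 * (b p p v - b p p 0)) = q.[0].
    by rewrite dE /q !hornerE /=; ring.
  apply: horner_cvg0.
  - exact: cvg_within.
  - near=> h; have h0 : h != 0 by near: h; exact: nbhs_dnbhs_neq.
    rewrite /= (_ : h *: v + p = (1 - h) *: p + h *: (p + v)); last first.
      by apply: rv2_eq; rewrite !mxE; ring.
    rewrite (blossom_curve bP) -(blossom_diag bP) /q !hornerE /= /GRing.scale /=.
    by field.
split; first by apply/cvg_ex; eexists; exact: lim0.
exact: cvg_lim lim0.
Unshelve. all: by end_near. Qed.

End Triangles.

Section C1.
Local Open Scope classical_set_scope.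
Context {R : realType}.
Implicit Types (p v a m c : 'rV[R]_2) (f : 'rV[R]_2 -> R).
Implicit Types (P S : 'rV[R]_2 -> R).
Implicit Types (b : 'rV[R]_2 -> 'rV[R]_2 -> 'rV[R]_2 -> R).

(** At a boundary point no derivative of [S] is given. Approaching [p] from inside the triangle, [g]
    equals the derivative of [P], and continuity of [g] on [A] carries the equality to the limit. *)
Lemma C1_gradient (A : set 'rV[R]_2) S P b (g : 'rV[R]_2 -> R) v a m c p :
  {within A, continuous g} ->
  (forall r, interior A r -> is_derive r v (S : 'rV[R]_2 -> R^o) (g r)) ->
  is_blossom P b -> det3 a m c != 0 ->
  hull [:: a; m; c] `<=` A -> (forall r, hull [:: a; m; c] r -> S r = P r) ->
  hull [:: a; m; c] p -> g p = 3 * (b p p v - b p p 0).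
Proof.
move=> cg dg bP d0 HA SP hp.
have [x [y [z [x0 y0 z0 s1 pE]]]] := (hull3P _ _ _ _).1 hp.
(* The path runs from [p] to the centroid [w] and is interior to the triangle for all parameters in
   (0, 1]. *)
pose w := 3^-1 *: a + 3^-1 *: m + 3^-1 *: c.
pose u s : 'rV[R]_2 := (1 - s) *: p + s *: w.
have nu s : 0 < s -> s <= 1 -> nbhs (u s) (hull [:: a; m; c]).
  move=> s0 s_le1.
  have -> : u s = ((1 - s) * x + s / 3) *: a + ((1 - s) * y + s / 3) *: m
      + ((1 - s) * z + s / 3) *: c.
    by apply: rv2_eq; rewrite /u /w pE !mxE; ring.
  have s1' : 0 <= 1 - s by lra.
  have [? ? ?] := And3 (mulr_ge0 s1' x0) (mulr_ge0 s1' y0) (mulr_ge0 s1' z0).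
  apply: nbhs_hull3 => //; [lra..|].
  by rewrite (_ : z = 1 - x - y); [field|lra].
(* The derivative of [P] in direction [v] along the path, a quadratic in the parameter. *)
pose q : {poly R} := 3%:P * ((1 - 'X) ^+ 2 * (b p p v - b p p 0)%:P
   + 2%:P * (1 - 'X) * 'X * (b p w v - b p w 0)%:P
   + 'X ^+ 2 * (b w w v - b w w 0)%:P).
have guE s : 0 < s -> s <= 1 -> g (u s) = q.[s].
  move=> s0 s_le1; have nus := nu s s0 s_le1.
  have dS : is_derive (u s) v (S : 'rV[R]_2 -> R^o) (g (u s)).
    by apply: dg; apply: filterS nus.
  have dP : is_derive (u s) v (P : 'rV[R]_2 -> R^o) (g (u s)).
    by apply: near_eq_is_derive dS; apply: filterS nus.
  rewrite -(@derive_val _ _ _ _ _ _ _ dP).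
  rewrite (@derive_val _ _ _ _ _ _ _ (blossom_is_derive _ _ bP)).
  by rewrite /u !(blossom_curve2 bP) /q !hornerE /=; ring.
have near01 : \forall s \near 0^'+, 0 < s <= (1 : R).
  near=> s; apply/andP; split; near: s.
    exact: nbhs_right_gt.
  by apply: nbhs_right_le.
have gq : g (u s) @[s --> 0^'+] --> q.[0].
  apply: horner_cvg0.
    exact: cvg_within.
  by apply: filterS near01 => s /andP[s0 s_le1]; exact: guE.
have cu : u s @[s --> 0^'+] --> within A (nbhs p).
  have up : u s @[s --> 0^'+] --> p.
    have -> : u = fun s => p + s *: (w - p).
      by apply/funext => s; apply: rv2_eq; rewrite !mxE; ring.
    have id0 : (s : R) @[s --> 0^'+] --> (0 : R) by exact: cvg_within.
    have := cvgD (cvg_cst p) (@cvgZr_tmp R _ _ _ _ _ _ (w - p) id0).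
    by rewrite scale0r addr0; apply.
  move=> W /up /= nW; apply: filterS2 near01 nW => s /andP[s0 s_le1] /=.
  by apply; apply: HA; apply: nbhs_singleton; exact: nu.
have gp : g (u s) @[s --> 0^'+] --> g p.
  have/subspace_continuousP/(_ p (HA _ hp)) cgp := cg.
  exact: cvg_trans (cvg_app g cu) cgp.
rewrite (cvg_unique _ gp gq) // /q !hornerE /=; ring.
Unshelve. all: by end_near. Qed.

End C1.

(** * Geometry of the refinement *)

Section Mesh.
Context {R : realType} {V : finType}.
Variables (D : mesh R V) (Q : split R V).
Hypotheses (hD : is_triangulation D) (hQ : is_PS D Q).
Implicit Types (i j k : V) (e t : {set V}) (p : 'rV[R]_2) (S : 'rV[R]_2 -> R).

(** Bridge between [hull], whose weights are indexed by list positions, and sums over vertex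
    sets. *)
Lemma sum_enum (T : nmodType) e (i0 : V) (F : V -> nat -> T) :
  \sum_(n < size (enum e)) F (nth i0 (enum e) n) n =
  \sum_(i in e) F i (index i (enum e)).
Proof.
rewrite -[RHS]big_enum (big_nth i0) big_mkord /=. apply: eq_bigr => n _.
by rewrite index_uniq ?ltn_ord ?enum_uniq.
Qed.

(** The clause [a i = w n] transfers any sign condition on the weights, so one lemma serves both
    [hull] and [inside]. *)
Lemma sum_weights e (w : nat -> R) (s := [seq vtx D i | i in e]) :
  \sum_(n < size s) w n = 1 ->
  exists a : V -> R, [/\ forall i, exists n, a i = w n, \sum_(i in e) a i = 1 &
    \sum_(n < size s) w n *: s`_n = \sum_(i in e) a i *: vtx D i].
Proof.
rewrite /s size_map; have [->|[i0 i0e]] := set_0Vmem e.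
  by rewrite enum_set0 big_ord0 => /esym/eqP; rewrite oner_eq0.
move=> s1; exists (fun i => w (index i (enum e))); split.
- by move=> i; exists (index i (enum e)).
- by rewrite -s1 -(sum_enum _ i0 (fun=> w)).
- rewrite -(sum_enum _ i0 (fun i n => w n *: vtx D i)).
  by apply: eq_bigr => n _; rewrite (nth_map i0).
Qed.

Lemma cell_bary e p : cell D e p -> exists a : V -> R,
  [/\ forall i, 0 <= a i, \sum_(i in e) a i = 1 &
    p = \sum_(i in e) a i *: vtx D i].
Proof.
case=> w [w0 /sum_weights[a [aw a1 aE]] ->]; exists a; split=> // i.
by have [n ->] := aw i.
Qed.

Lemma inside_bary e p : inside [seq vtx D i | i in e] p -> exists a : V -> R,
  [/\ forall i, 0 < a i, \sum_(i in e) a i = 1 &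
    p = \sum_(i in e) a i *: vtx D i].
Proof.
case=> w [w0 /sum_weights[a [aw a1 aE]] ->]; exists a; split=> // i.
by have [n ->] := aw i.
Qed.

Lemma bary_cell e p (a : V -> R) : (forall i, i \in e -> 0 <= a i) ->
  \sum_(i in e) a i = 1 -> p = \sum_(i in e) a i *: vtx D i -> cell D e p.
Proof.
move=> a0 a1 ->; have [e0|[i0 i0e]] := set_0Vmem e.
  by move/eqP: a1; rewrite e0 big_set0 eq_sym oner_eq0.
(* The sign of [a] is known on [e] only, so positions beyond the enumeration get weight 0. *)
exists (fun n => if (n < size (enum e))%N then a (nth i0 (enum e) n) else 0).
rewrite size_map; split.
- by move=> n; case: ifP => // ne; apply: a0; rewrite -mem_enum mem_nth.
- rewrite -a1 -(sum_enum _ i0 (fun i _ => a i)); apply: eq_bigr => n _.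
  by rewrite ltn_ord.
- rewrite -(sum_enum _ i0 (fun i _ => a i *: vtx D i)); apply: eq_bigr => n _.
  by rewrite ltn_ord (nth_map i0).
Qed.

Lemma sum_pair (T : nmodType) i j (F : V -> T) : i != j ->
  \sum_(l in [set i; j]) F l = F i + F j.
Proof. by move=> ij; rewrite big_setU1 ?inE // big_set1. Qed.

Lemma sum_triple (T : nmodType) i j k (F : V -> T) : i != j -> i != k -> j != k ->
  \sum_(l in [set i; j; k]) F l = F i + F j + F k.
Proof.
move=> ij ik jk; have kn : k \notin [set i; j].
  by rewrite !inE negb_or eq_sym ik eq_sym jk.
by rewrite setUC big_setU1 //= sum_pair // addrC.
Qed.

Definition triple i j k t :=
  [/\ t \in tris D, t = [set i; j; k], i != j, i != k & j != k].

Lemma triple_swap i j k t : triple i j k t -> triple j i k t.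
Proof.
case=> tT tE ij ik jk; split=> //; last by rewrite eq_sym.
by rewrite tE (setUC [set i]).
Qed.

Lemma triple_rot i j k t : triple i j k t -> triple i k j t.
Proof.
case=> tT tE ij ik jk; split=> //; last by rewrite eq_sym.
by rewrite tE -!setUA (setUC [set j]).
Qed.

Lemma triple_micro i j k t : triple i j k t -> is_micro D i j t.
Proof.
by case=> tT tE ij _ _; rewrite /is_micro ij inE tT tE subsetUl.
Qed.

Lemma micro_triple i j t : is_micro D i j t -> exists k, triple i j k t.
Proof.
case/andP=> ij; rewrite inE => /andP[tT st].
have : #|t :\: [set i; j]| == 1%N.
  by rewrite cardsD (setIidPr st) (card_tri hD tT) cards2 ij.
case/cards1P=> k kE.
have /setDP[_] : k \in t :\: [set i; j] by rewrite kE set11.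
rewrite !inE negb_or => /andP[ki kj]; exists k; split=> //; try by rewrite eq_sym.
by rewrite -kE setUC -{1}(setID t [set i; j]) (setIidPr st) setUC.
Qed.

Lemma micro_swap i j t : is_micro D i j t -> is_micro D j i t.
Proof. by rewrite /is_micro eq_sym setUC. Qed.

Lemma micro_edge i j t : is_micro D i j t -> [set i; j] \in edges D.
Proof.
case/andP=> ij; rewrite inE => /andP[tT st]; apply: (edge_of_tri hD tT st).
by rewrite cards2 ij.
Qed.

Lemma tri_triple t i : t \in tris D -> i \in t -> exists j k, triple i j k t.
Proof.
move=> tT it; have /card_gt0P[j] : (0 < #|t :\ i|)%N.
  by have := cardsD1 i t; rewrite it (card_tri hD tT); case: #|_|.
rewrite !inE => /andP[ji jt]; exists j; apply: micro_triple.
rewrite /is_micro eq_sym ji inE tT; apply/fintype.subsetP => l.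
by rewrite !inE => /orP[/eqP->|/eqP->].
Qed.

Lemma tpt_bary i j k t : triple i j k t -> exists x y z : R,
  [/\ 0 < x, 0 < y, 0 < z, x + y + z = 1 &
    tpt Q t = x *: vtx D i + y *: vtx D j + z *: vtx D k].
Proof.
case=> tT tE ij ik jk; have [a [a0 a1 aE]] := inside_bary (tpt_inside hQ tT).
exists (a i), (a j), (a k); by move: a1; rewrite aE tE !sum_triple.
Qed.

Lemma ept_bary i j : i != j -> [set i; j] \in edges D -> exists x : R,
  [/\ 0 < x, x < 1 & ept Q [set i; j] = (1 - x) *: vtx D i + x *: vtx D j].
Proof.
move=> ij eE; have [a [a0 a1 aE]] := inside_bary (ept_inside hQ eE).
move: a1; rewrite aE !sum_pair // => a1; exists (a j).
have := a0 i; have := a0 j => aj ai; split=> //; first lra.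
by congr (_ *: _ + _); lra.
Qed.

(** The small triangle has the fraction [l * z] of the area of the mesh triangle, where [l] and [z]
    are the positive coordinates of the edge point at [j] and of the split point at [k]. *)
Lemma micro_det i j t : is_micro D i j t ->
  det3 (vtx D i) (ept Q [set i; j]) (tpt Q t) != 0.
Proof.
move=> ijt; have [k ijk] := micro_triple ijt.
have [tT tE ij ik jk] := ijk.
have [x [y [z [x0 y0 z0 s1 ->]]]] := tpt_bary ijk.
have [l [l0 l1 ->]] := ept_bary ij (micro_edge ijt).
have ncol : ~ collinear (vtx D i) (vtx D j) (vtx D k).
  by apply: (nondegenerate hD); rewrite -tE.
have -> : forall a b c : 'rV[R]_2, det3 a ((1 - l) *: a + l *: b)
    (x *: a + y *: b + z *: c) = l * z * det3 a b c.
  by move=> a b c; rewrite (_ : x = 1 - y - z) /det3 ?mxE; [ring | lra].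
by rewrite !mulf_neq0 ?det3_neq0 // lt0r_neq0.
Qed.

Lemma micro_sub_cell i j t : is_micro D i j t -> (micro D Q i j t `<=` cell D t)%classic.
Proof.
move=> ijt p; have [k ijk] := micro_triple ijt.
have [tT tE ij ik jk] := ijk.
case/hull3P=> u [v [w [u0 v0 w0 s1 ->]]].
have [x [y [z [x0 y0 z0 s1' ->]]]] := tpt_bary ijk.
have [l [l0 l1 ->]] := ept_bary ij (micro_edge ijt).
(* Coefficients of the three mesh vertices after expanding the edge point and the split point. *)
pose a n := if n == i then u + v * (1 - l) + w * x else
            if n == j then v * l + w * y else w * z.
have [ai aj ak] : [/\ a i = u + v * (1 - l) + w * x, a j = v * l + w * y & a k = w * z].
  by rewrite /a !eqxx (eq_sym j) (negPf ij) !(eq_sym k) (negPf ik) (negPf jk).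
apply: (bary_cell (a := a)).
- have [? ? ?] := And3 (ltW x0) (ltW y0) (ltW z0).
  have ? := ltW l0; have ? : 0 <= 1 - l by lra.
  by move=> n _; rewrite /a; do 2?case: ifP => _; rewrite ?addr_ge0 ?mulr_ge0.
- rewrite tE sum_triple // ai aj ak.
  have -> : x = 1 - y - z by lra.
  have -> : u = 1 - v - w by lra.
  by ring.
- rewrite tE sum_triple // ai aj ak.
  by apply: rv2_eq; rewrite !mxE; ring.
Qed.

Lemma cell_sub_Omega t : t \in tris D -> (cell D t `<=` Omega D)%classic.
Proof. by move=> tT p ctp; exists t. Qed.

Lemma micro_sub_Omega i j t : is_micro D i j t -> (micro D Q i j t `<=` Omega D)%classic.
Proof.
move=> ijt p mp; apply: cell_sub_Omega (micro_sub_cell ijt mp).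
by case/andP: ijt => _; rewrite inE => /andP[].
Qed.

(* Subtracting from the barycentric coordinates [a] of the point the largest
   possible multiple of those of the split point moves it to an edge. *)
Lemma cell_micro t p : t \in tris D -> cell D t p ->
  exists i j, is_micro D i j t /\ micro D Q i j t p.
Proof.
move=> tT /cell_bary[a [a0 a1 pE]].
have [g [g0 g1 gE]] := inside_bary (tpt_inside hQ tT).
have [k0 k0t] : exists k, k \in t.
  by apply/set0Pn; rewrite -card_gt0 (card_tri hD tT).
have [k kt kmin] := arg_minP (fun k => a k / g k) k0t.
have [i [j kij]] := tri_triple tT kt.
have [_ tE ki kj ij] := kij.
pose r := a k / g k; have rg l : l \in t -> r * g l <= a l.
  by move=> /kmin; rewrite ler_pdivlMr.
have it : i \in t by rewrite tE !inE eqxx orbT.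
have jt : j \in t by rewrite tE !inE eqxx orbT.
have r0 : 0 <= r by rewrite divr_ge0 // ltW.
have rk : r * g k = a k by rewrite divfK // gt_eqF.
have ijk : triple i j k t by exact: triple_rot (triple_swap kij).
(* With [u] at ratio [h] on the edge, comparing [x / (1 - h)] with [y / h] tells on which side of
   the line through [u] and the split point the given point lies; the endpoint on the other side is
   then eliminated in favour of [u]. *)
have half l n (u := ept Q [set l; n]) : l != n -> [set l; n] \in edges D ->
    forall x y z, 0 <= x -> 0 <= y -> 0 <= z -> x + y + z = 1 ->
    (exists2 s, [\/ s = l | s = n] & hull [:: vtx D s; u; tpt Q t]
      (x *: vtx D l + y *: vtx D n + z *: tpt Q t)).
  move=> ln lnE x y z x0 y0 z0 s1.
  have [h [h0 h1]] := ept_bary ln lnE; rewrite -/u => uE.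
  have [le_xy|lt_xy] := leP (x * h) (y * (1 - h)).
    have y'0 : 0 <= y - x * h / (1 - h) by rewrite subr_ge0 ler_pdivrMr; lra.
    have x'0 : 0 <= x / (1 - h) by rewrite divr_ge0; lra.
    exists n; first by right.
    apply/hull3P; exists (y - x * h / (1 - h)), (x / (1 - h)), z; split=> //.
      have -> : z = 1 - x - y by lra.
      by field; lra.
    by apply: rv2_eq; rewrite uE !mxE; field; lra.
  have x'0 : 0 <= x - y * (1 - h) / h by rewrite subr_ge0 ler_pdivrMr; lra.
  have y'0 : 0 <= y / h by rewrite divr_ge0; lra.
  exists l; first by left.
  apply/hull3P; exists (x - y * (1 - h) / h), (y / h), z; split=> //.
    have -> : z = 1 - x - y by lra.
    by field; lra.
  by apply: rv2_eq; rewrite uE !mxE; field; lra.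
have ijt := triple_micro ijk; have jit := micro_swap ijt.
have ijE := micro_edge ijt.
have ks : forall l, l \in t -> 0 <= a l - r * g l by move=> l lt; rewrite subr_ge0 rg.
have s1 : a i - r * g i + (a j - r * g j) + r = 1.
  move: a1 g1; rewrite tE !sum_triple // => a1 g1.
  have : r * g k + r * g i + r * g j = r by rewrite -!mulrDr g1 mulr1.
  by lra.
have pE' : p = (a i - r * g i) *: vtx D i + (a j - r * g j) *: vtx D j + r *: tpt Q t.
  rewrite pE gE tE !sum_triple // -rk.
  by apply: rv2_eq; rewrite !mxE; ring.
have [s [->|->]] := half _ _ ij ijE _ _ _ (ks _ it) (ks _ jt) r0 s1; rewrite -pE' => hp.
  by exists i, j.
by exists j, i; split=> //; rewrite /micro (setUC [set j]).
Qed.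

Lemma hull_convex (s : seq 'rV[R]_2) p q (u : R) : 0 <= u <= 1 ->
  hull s p -> hull s q -> hull s ((1 - u) *: p + u *: q).
Proof.
move=> /andP[u0 u1] [a [a0 a1 ->]] [b [b0 b1 ->]].
have u'0 : 0 <= 1 - u by lra.
exists (fun n => (1 - u) * a n + u * b n); split.
- by move=> n; rewrite addr_ge0 // mulr_ge0.
- by rewrite big_split /= -!mulr_sumr a1 b1; ring.
- rewrite !scaler_sumr -big_split; apply: eq_bigr => n _ /=.
  by rewrite !scalerA scalerDl.
Qed.

Lemma micro_corners i j t :
  [/\ micro D Q i j t (vtx D i), micro D Q i j t (ept Q [set i; j]) &
      micro D Q i j t (tpt Q t)].
Proof. exact: hull3_corners. Qed.

End Mesh.

(** * Bernstein coefficients of splines *)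

Section Unique.
Context {R : realType}.

Lemma affine_ext (f f' : 'rV[R]_2 -> R) a m c : det3 a m c != 0 ->
  affine_fun f -> affine_fun f' -> f a = f' a -> f m = f' m -> f c = f' c ->
  f =1 f'.
Proof.
move=> d0 fA fA' ea em ec p; have := barycentric p d0.
move: (_ / _) (_ / _) (_ / _) => x y z [-> s1].
by rewrite !affine_fun3 // ea em ec.
Qed.

(** Polarization at points of the hull only evaluates the cubics in the hull, so the blossoms agree
    there. Affinity and symmetry then free the arguments one at a time. *)
Lemma cubic_hull_unique (P P' : 'rV[R]_2 -> R) a m c : det3 a m c != 0 ->
  cubic P -> cubic P' -> (forall p, hull [:: a; m; c] p -> P p = P' p) ->
  P = P'.
Proof.
move=> d0 /polar_blossom bP /polar_blossom bP' PP'.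
pose H := hull [:: a; m; c].
have [Ha Hm Hc] := hull3_corners a m c.
have H2 x y : H x -> H y -> H (2^-1 *: (x + y)).
  move=> Hx Hy; have -> : 2^-1 *: (x + y) = (1 - 2^-1) *: x + 2^-1 *: y.
    by apply: rv2_eq; rewrite !mxE; field.
  by apply: hull_convex => //; lra.
have H3 x y z : H x -> H y -> H z -> H (3^-1 *: (x + y + z)).
  move=> Hx Hy Hz.
  have -> : 3^-1 *: (x + y + z) = (1 - 3^-1) *: (2^-1 *: (x + y)) + 3^-1 *: z.
    by apply: rv2_eq; rewrite !mxE; field.
  by apply: hull_convex => //; [lra | exact: H2].
have e0 x y z : H x -> H y -> H z -> polar P x y z = polar P' x y z.
  by move=> Hx Hy Hz; rewrite /polar !PP' //; [exact: H2 | exact: H2 | exact: H2 | exact: H3].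
have step x y : polar P x y a = polar P' x y a -> polar P x y m = polar P' x y m ->
    polar P x y c = polar P' x y c -> polar P x y =1 polar P' x y.
  exact: (affine_ext d0 (blossom_affine bP x y) (blossom_affine bP' x y)).
have [s12 s23 _ _] := bP; have [s12' s23' _ _] := bP'.
have e1 x y z : H x -> H y -> polar P x y z = polar P' x y z.
  by move=> Hx Hy; rewrite (step x y) ?e0.
have e2 x y z : H x -> polar P x y z = polar P' x y z.
  by move=> Hx; rewrite (step x y) // s23 s23' ?e1.
apply/funext => p; rewrite -(blossom_diag bP) -(blossom_diag bP').
by rewrite (step p p) // s23 s12 s23' s12' ?e2.
Qed.

End Unique.

Section Splines.
Context {R : realType} {V : finType}.
Variables (D : mesh R V) (Q : split R V).
Hypotheses (hD : is_triangulation D) (hQ : is_PS D Q).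
Implicit Types (i j k : V) (e t : {set V}) (p : 'rV[R]_2) (S : 'rV[R]_2 -> R).

(** Small triangles are nondegenerate, so the cubic chosen by [piece] is the given [P]. *)
Lemma micro_blossom_polar S P i j t : is_micro D i j t -> cubic P ->
  (forall p, micro D Q i j t p -> S p = P p) -> micro_blossom D Q S i j t = polar P.
Proof.
move=> ijt Pc SP; rewrite /micro_blossom.
rewrite (_ : piece _ _ = P) ?blossom_polar //.
apply: xget_unique; first by split.
move=> P' [P'c SP']; apply: (cubic_hull_unique (micro_det hD hQ ijt)) => // p hp.
by rewrite -SP // SP'.
Qed.

Lemma micro_blossomP S i j t : spline D Q S -> is_micro D i j t ->
  exists P, [/\ cubic P, forall p, micro D Q i j t p -> S p = P p &
    is_blossom P (micro_blossom D Q S i j t)].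
Proof.
move=> [_ hS] ijt; have [P Pc SP] := hS _ _ _ ijt; exists P; split=> //.
by rewrite (micro_blossom_polar ijt Pc SP); exact: polar_blossom.
Qed.

(** Both gradients at [p] are the value of the same continuous extension, and both polynomials take
    the value [S p]. Sharing a single point suffices, even across mesh triangles. *)
Lemma micro_blossom_vertex S i j t i' j' t' p x : spline D Q S ->
  is_micro D i j t -> is_micro D i' j' t' ->
  micro D Q i j t p -> micro D Q i' j' t' p ->
  micro_blossom D Q S i j t p p x = micro_blossom D Q S i' j' t' p p x.
Proof.
move=> sS mt mt' hp hp'.
have [P [_ SP bP]] := micro_blossomP sS mt.
have [P' [_ SP' bP']] := micro_blossomP sS mt'.
have [[_ C1S] _] := sS.
set b := micro_blossom _ _ _ _ _ _ in bP *; set b' := micro_blossom _ _ _ _ _ _ in bP' *.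
have grad v : b p p v - b p p 0 = b' p p v - b' p p 0.
  have [g cg dg] := C1S v.
  have gE := C1_gradient cg dg bP (micro_det hD hQ mt)
    (micro_sub_Omega hD hQ mt) SP hp.
  have gE' := C1_gradient cg dg bP' (micro_det hD hQ mt')
    (micro_sub_Omega hD hQ mt') SP' hp'.
  by lra.
have pp : b p p p = b' p p p.
  by rewrite (blossom_diag bP) (blossom_diag bP') -SP // SP'.
(* [grad p] and [pp] identify the values at 0; [grad x] then gives those at [x]. *)
by have := grad p; have := grad x; lra.
Qed.

(* Polarization of the previous lemma along the segment [p, q]. *)
Lemma micro_blossom_edge S i j t i' j' t' p q x : spline D Q S ->
  is_micro D i j t -> is_micro D i' j' t' ->
  micro D Q i j t p -> micro D Q i' j' t' p ->
  micro D Q i j t q -> micro D Q i' j' t' q ->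
  micro_blossom D Q S i j t p q x = micro_blossom D Q S i' j' t' p q x.
Proof.
move=> sS mt mt' hp hp' hq hq'.
have [P [_ _ bP]] := micro_blossomP sS mt.
have [P' [_ _ bP']] := micro_blossomP sS mt'.
have u01 : 0 <= (2^-1 : R) <= 1 by lra.
(* At the midpoint of the segment the mixed value enters with a nonzero factor, and the two end
   values already agree. *)
have := micro_blossom_vertex x sS mt mt' (hull_convex u01 hp hq) (hull_convex u01 hp' hq').
rewrite (blossom_curve2 bP) (blossom_curve2 bP').
rewrite (micro_blossom_vertex x sS mt mt' hp hp') (micro_blossom_vertex x sS mt mt' hq hq').
by lra.
Qed.

(* [K] is a convex cone of reals: the local values of a spline inherit
   membership in [K] from its local degrees of freedom. It is instantiated with
   the nonnegative reals and with {0}. *)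
Section Cone.
Variable q : V -> 'I_3 -> 'rV[R]_2.
Hypothesis hq : forall i, is_vertex_triangle D Q i (q i).
Variable K : R -> Prop.
Hypothesis KK : forall a b x y, 0 <= a -> 0 <= b -> K x -> K y -> K (a * x + b * y).
Variable S : 'rV[R]_2 -> R.
Hypothesis sS : spline D Q S.

Let b := micro_blossom D Q S.

Let K3 a1 a2 a3 x y z : 0 <= a1 -> 0 <= a2 -> 0 <= a3 -> K x -> K y -> K z ->
  K (a1 * x + a2 * y + a3 * z).
Proof.
by move=> ? ? ? ? ? ?; rewrite -[_ + _ * y]mul1r; apply: KK => //; exact: KK.
Qed.

Let b12 i j t x y z : is_micro D i j t -> b i j t x y z = b i j t y x z.
Proof. by move=> /(micro_blossomP sS)[? [_ _ []]]. Qed.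
Let b23 i j t x y z : is_micro D i j t -> b i j t x y z = b i j t x z y.
Proof. by move=> /(micro_blossomP sS)[? [_ _ []]]. Qed.

Let b_bary i j t x y a m c (u v w : R) : is_micro D i j t -> u + v + w = 1 ->
  b i j t x y (u *: a + v *: m + w *: c) =
  u * b i j t x y a + v * b i j t x y m + w * b i j t x y c.
Proof. by move=> /(micro_blossomP sS)[? [_ _ bP]]; exact: (blossom_bary bP). Qed.

Let b_seg i j t x y a m (u : R) : is_micro D i j t ->
  b i j t x y ((1 - u) *: a + u *: m) = (1 - u) * b i j t x y a + u * b i j t x y m.
Proof. by move=> /(micro_blossomP sS)[? [_ _ bP]]; exact: (blossom_seg bP). Qed.

Lemma pick_micro i : exists j t, [/\ is_micro D i j t &
  forall r, beta D Q q (Dv i r) S = b i j t (vtx D i) (vtx D i)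
     (vtx D i + 3 *: (q i r - vtx D i))].
Proof.
rewrite /beta; case: pickP => [[j t] /= ijt|none]; first by exists j, t.
(* The default branch of [beta] cannot occur, since every vertex lies in a triangle. *)
have [t tT it] := vtx_covered hD i.
have [j [k ijk]] := tri_triple hD tT it.
by have := none (j, t); rewrite /= (triple_micro ijk).
Qed.

Lemma cone_vertex i j t x : is_micro D i j t ->
  (forall r, K (beta D Q q (Dv i r) S)) ->
  hull [:: q i 0; q i 1; q i 2] ((2 / 3) *: vtx D i + (1 / 3) *: x) ->
  K (b i j t (vtx D i) (vtx D i) x).
Proof.
move=> ijt Kv /hull3P[u [v [w [u0 v0 w0 s1 E]]]].
have [j' [t' [ijt' betaE]]] := pick_micro i.
have [vi _ _] := micro_corners D Q i j t; have [vi' _ _] := micro_corners D Q i j' t'.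
rewrite /b (micro_blossom_vertex _ sS ijt ijt') // -/b.
(* Scaling the vertex triangle by 3 about [v_i] gives a triangle containing [x], at whose corners
   the blossom takes the values [beta]. *)
pose s r := vtx D i + 3 *: (q i r - vtx D i).
have -> : x = u *: s 0 + v *: s 1 + w *: s 2.
  have -> : x = 3 *: ((2 / 3) *: vtx D i + (1 / 3) *: x) - 2 *: vtx D i.
    by apply: rv2_eq; rewrite !mxE; field.
  rewrite E (_ : u = 1 - v - w); last by lra.
  by apply: rv2_eq; rewrite !mxE; ring.
by rewrite b_bary // -!betaE; exact: K3.
Qed.

Section LocalTriangle.
Variable t : {set V}.
Hypothesis tT : t \in tris D.
Hypothesis Kv : forall i r, i \in t -> K (beta D Q q (Dv i r) S).
(** Here [t'] may also be the neighbour of [t] across the edge: its functional enters the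
    coefficient at the edge split point. *)
Hypothesis Kt : forall i j t', [set i; j] \subset t -> is_micro D i j t' ->
  K (beta D Q q (Dt i j t') S).
Hypothesis Ke : forall i j, [set i; j] \subset t -> [set i; j] \in bedges D ->
  K (beta D Q q (De i j) S).

Section LocalMicro.
Variables i j : V.
Hypothesis ijt : is_micro D i j t.
Local Notation a := (vtx D i).
Local Notation m := (ept Q [set i; j]).
Local Notation c := (tpt Q t).
Local Notation b0 := (b i j t).

Let sub_ij : [set i; j] \subset t.
Proof. by case/andP: ijt => _; rewrite inE => /andP[]. Qed.
Let it : i \in t. Proof. by apply: (fintype.subsetP sub_ij); rewrite !inE eqxx. Qed.

(** In the names [cone_xyz] the letters are the blossom arguments: [a] is the vertex [i], [b] the
    vertex [j], [m] the edge point and [c] the split point of [t]. *)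
Lemma cone_aaa : K (b0 a a a).
Proof.
apply: cone_vertex => //; first by move=> r; exact: Kv.
rewrite -scalerDl (_ : 2 / 3 + 1 / 3 = 1) ?scale1r; last by field.
by case: (hq i).
Qed.

Lemma cone_aac : K (b0 a a c).
Proof.
apply: cone_vertex => //; first by move=> r; exact: Kv.
by case: (hq i) => _ _ h _; exact: h.
Qed.

Lemma cone_aam : K (b0 a a m).
Proof.
apply: cone_vertex => //; first by move=> r; exact: Kv.
case: (hq i) => _ _ _ h; apply: h; first exact: micro_edge ijt.
by rewrite !inE eqxx.
Qed.

Lemma cone_abc : K (b0 a (vtx D j) c).
Proof. exact: Kt. Qed.

(** The edge point is a convex combination of the ends of its edge, which reduces the claim to
    [cone_aac] and [cone_abc]. *)
Lemma cone_amc : K (b0 a m c).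
Proof.
have /andP[ij _] := ijt.
have [l [l0 l1 mE]] := ept_bary hQ ij (micro_edge hD ijt).
rewrite b23 // mE b_seg // !(b23 _ c) //.
by apply: KK; [lra | lra | exact: cone_aac | exact: cone_abc].
Qed.

(* On an interior edge the split point lies between the two adjacent triangle
   split points, and the pieces on both sides have the same blossom here. *)
Lemma cone_abm : K (b0 a (vtx D j) m).
Proof.
have /andP[ij tij] := ijt; have eE := micro_edge hD ijt.
have [be|ie] := boolP ([set i; j] \in bedges D).
  have := Ke sub_ij be; rewrite /beta; case: pickP => [t' t'ij|/(_ t)]; last by rewrite tij.
  have /eqP/cards1P[t0 tE] := boundary_edge hD be.
  by move: tij t'ij; rewrite tE !inE => /eqP-> /eqP->.
have [t' t't t'ij] : exists2 t', t' != t & t' \in tris_at D [set i; j].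
  have := interior_edge hD eE ie; rewrite (cardsD1 t) tij => -[/eqP/cards1P[t' t'E]].
  have : t' \in tris_at D [set i; j] :\ t by rewrite t'E set11.
  by rewrite !inE => /andP[? ?]; exists t' => //; rewrite inE.
have ijt' : is_micro D i j t' by rewrite /is_micro ij.
have : (hull [:: tpt Q t; tpt Q t'] `&` cell D [set i; j])%classic m.
  by rewrite (ept_meet hQ eE ie tij t'ij) // eq_sym.
case=> /hull2P[x [y [x0 y0 s1 mE]]] _.
have [va vm _] := micro_corners D Q i j t; have [va' vm' _] := micro_corners D Q i j t'.
have [l [l0 l1 mE']] := ept_bary hQ ij eE.
(* The vertex [j] is outside both small triangles. The blossoms agree at [(a, m, z)] and
   [(a, a, z)], and [m] has a nonzero coordinate [l] at [j], so the value at [j] can be solved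
   for. *)
have same z : b0 a (vtx D j) z = b i j t' a (vtx D j) z.
  have e1 : b0 a m z = b i j t' a m z by exact: micro_blossom_edge.
  have e2 : b0 a a z = b i j t' a a z by exact: micro_blossom_vertex.
  move: e1; rewrite ![b _ _ _ a m z]b23 // {1 2}mE' !b_seg // !(b23 _ z) // e2.
  by move=> /addrI /mulfI; apply; rewrite gt_eqF.
have -> : m = x *: c + y *: tpt Q t' by [].
have -> : x = 1 - y by lra.
rewrite b_seg // (same (tpt Q t')).
by apply: KK; [lra | lra | exact: Kt | exact: Kt].
Qed.

Lemma cone_amm : K (b0 a m m).
Proof.
have /andP[ij _] := ijt.
have [l [l0 l1 mE]] := ept_bary hQ ij (micro_edge hD ijt).
rewrite {2}mE b_seg // !(b23 _ m) //.
by apply: KK; [lra | lra | exact: cone_aam | exact: cone_abm].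
Qed.

End LocalMicro.

(** One [c] is expanded over the three vertices of [t]. The term at the third vertex is read in the
    small triangle across the segment from [a] to [c]. *)
Lemma cone_acc i j (c := tpt Q t) : is_micro D i j t -> K (b i j t (vtx D i) c c).
Proof.
move=> ijt; have [k ijk] := micro_triple hD ijt.
have ikt := triple_micro (triple_rot ijk).
have [x [y [z [x0 y0 z0 s1 cE]]]] := tpt_bary hQ ijk.
have [va _ vc] := micro_corners D Q i j t; have [va' _ vc'] := micro_corners D Q i k t.
rewrite {2}/c cE b_bary //; apply: K3; try exact: ltW.
- by rewrite b23 //; exact: cone_aac.
- by rewrite b23 //; exact: cone_abc.
- rewrite /b (micro_blossom_edge _ sS ijt ikt) // -/b b23 //; exact: cone_abc.
Qed.

Section Midpoints.
Variables i j : V.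
Hypothesis ijt : is_micro D i j t.
Local Notation m := (ept Q [set i; j]).
Local Notation c := (tpt Q t).
Local Notation b0 := (b i j t).

Let jit : is_micro D j i t. Proof. exact: micro_swap. Qed.

Let corners_j : micro D Q j i t m /\ micro D Q j i t c.
Proof. by have [_] := micro_corners D Q j i t; rewrite (setUC [set j]). Qed.

(** The edge point is expanded over both ends of the edge, and the term at [j] is read in the half
    next to [j]. *)
Lemma cone_mid x y : (forall z, b0 x y z = b j i t x y z) ->
  K (b0 x y (vtx D i)) -> K (b j i t x y (vtx D j)) -> K (b0 x y m).
Proof.
move=> same Ki Kj; have /andP[ij _] := ijt.
have [l [l0 l1 mE]] := ept_bary hQ ij (micro_edge hD ijt).
by rewrite mE b_seg // (same (vtx D j)); apply: KK; [lra | lra | |].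
Qed.

Lemma cone_mcm : K (b0 m c m).
Proof.
have [_ vm vc] := micro_corners D Q i j t; have [vm' vc'] := corners_j.
apply: cone_mid.
- by move=> z; exact: micro_blossom_edge.
- by rewrite b23 // b12 //; exact: cone_amc.
- by rewrite b23 // b12 // (setUC [set i]); exact: cone_amc.
Qed.

Lemma cone_mmm : K (b0 m m m).
Proof.
have [_ vm vc] := micro_corners D Q i j t; have [vm' vc'] := corners_j.
apply: cone_mid.
- by move=> z; exact: micro_blossom_vertex.
- by rewrite b23 // b12 //; exact: cone_amm.
- by rewrite b23 // b12 // (setUC [set i]); exact: cone_amm.
Qed.

Lemma cone_ccm : K (b0 c c m).
Proof.
have [_ vm vc] := micro_corners D Q i j t; have [vm' vc'] := corners_j.
apply: cone_mid.
- by move=> z; exact: micro_blossom_vertex.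
- by rewrite b23 // b12 //; exact: cone_acc.
- by rewrite b23 // b12 //; exact: cone_acc.
Qed.

(** The three blossoms agree at [(c, c)], so each vertex term is read in a small triangle touching
    that vertex. *)
Lemma cone_ccc : K (b0 c c c).
Proof.
have [k ijk] := micro_triple hD ijt.
have kit := triple_micro (triple_swap (triple_rot ijk)).
have [x [y [z [x0 y0 z0 s1 cE]]]] := tpt_bary hQ ijk.
have [_ _ vc] := micro_corners D Q i j t; have [_ vc'] := corners_j.
have [_ _ vc''] := micro_corners D Q k i t.
rewrite {3}cE b_bary //; apply: K3; try exact: ltW.
- by rewrite b23 // b12 //; exact: cone_acc.
- rewrite /b (micro_blossom_vertex _ sS ijt jit) // -/b b23 // b12 //.
  exact: cone_acc.
- rewrite /b (micro_blossom_vertex _ sS ijt kit) // -/b b23 // b12 //.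
  exact: cone_acc.
Qed.

Lemma cone_micro p : micro D Q i j t p -> K (S p).
Proof.
move=> hp; have [P [_ SP bP]] := micro_blossomP sS ijt.
rewrite SP // -(blossom_diag bP) -/b.
move/hull3P: hp => [x [y [z [x0 y0 z0 s1 pE]]]].
have sub u v : K (b0 u v (vtx D i)) -> K (b0 u v m) -> K (b0 u v c) -> K (b0 u v p).
  by move=> ? ? ?; rewrite pE b_bary //; exact: K3.
have sub2 u : K (b0 u (vtx D i) (vtx D i)) -> K (b0 u (vtx D i) m) ->
    K (b0 u (vtx D i) c) -> K (b0 u m m) -> K (b0 u m c) -> K (b0 u c c) ->
    K (b0 u p p).
  move=> *; apply: (sub _ _); rewrite b23 //; apply: (sub _ _) => //;
    by rewrite b23.
have aam := cone_aam ijt; have aac := cone_aac ijt; have amc := cone_amc ijt.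
have amm := cone_amm ijt; have acc := cone_acc ijt.
have mcm := cone_mcm; have ccm := cone_ccm.
(* de Casteljau expansion of all three arguments: eighteen goals, six for each first argument [a],
   [m], [c], which are the ten Bernstein coefficients up to order. *)
apply: sub; rewrite b23 // b12 //; apply: sub2.
- exact: cone_aaa.
- by [].
- by [].
- by [].
- by [].
- by [].
- by rewrite b12 // b23.
- by rewrite b12.
- by rewrite b12.
- exact: cone_mmm.
- by rewrite b23.
- by rewrite b12 // b23.
- by rewrite b12 // b23.
- by rewrite b12 // b23 // b12 // b23 // b12.
- by rewrite b12.
- by rewrite b12 // b23.
- by rewrite b23.
- exact: cone_ccc.
Qed.

End Midpoints.

Lemma cone_cell p : cell D t p -> K (S p).
Proof. by move=> /(cell_micro hD hQ tT)[i [j [/cone_micro]]]; apply. Qed.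

End LocalTriangle.
End Cone.
End Splines.

(** * Reproduction of affine functions *)

Section Linearity.
Context {R : realType}.
Implicit Types (P S : 'rV[R]_2 -> R).

Lemma cubic_lin P1 P2 (k : R) : cubic P1 -> cubic P2 ->
  cubic (fun p => P1 p + k * P2 p).
Proof.
move=> [c1 E1] [c2 E2]; exists (fun i j => c1 i j + k * c2 i j) => p.
rewrite E1 E2 mulr_sumr -big_split; apply: eq_bigr => i _ /=.
by rewrite mulr_sumr -big_split; apply: eq_bigr => j _ /=; ring.
Qed.

Lemma polar_lin P1 P2 (k : R) x y z :
  polar (fun p => P1 p + k * P2 p) x y z = polar P1 x y z + k * polar P2 x y z.
Proof. by rewrite /polar; ring. Qed.

Lemma C1_on_lin (A : set 'rV[R]_2) S1 S2 (k : R) : C1_on A S1 -> C1_on A S2 ->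
  C1_on A (fun p => S1 p + k * S2 p).
Proof.
move=> [cS1 dS1] [cS2 dS2].
have lin (f1 f2 : 'rV[R]_2 -> R) : {within A, continuous f1}%classic ->
    {within A, continuous f2}%classic ->
    {within A, continuous (fun p => f1 p + k * f2 p)}%classic.
  move=> c1 c2 p; exact: (cvgD (c1 p) (@cvgMl_tmp R _ _ _ _ k _ (c2 p))).
split; first exact: lin.
move=> v; have [g1 cg1 dg1] := dS1 v; have [g2 cg2 dg2] := dS2 v.
exists (fun p => g1 p + k * g2 p); first exact: lin.
move=> p Ap; have d1 := dg1 p Ap; have d2 := dg2 p Ap.
exact: (is_deriveD d1 (is_deriveZ k d2)).
Qed.

Definition coord_affine (f : 'rV[R]_2 -> R) : Prop :=
  exists k0 k1 k2 : R, forall p, f p = k0 + k1 * p 0 0 + k2 * p 0 1.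

Lemma coord_affine_cubic f : coord_affine f -> cubic f.
Proof.
case=> k0 [k1 [k2 fE]].
exists (fun i j : 'I_4 => if (i == 0%N :> nat) && (j == 0%N :> nat) then k0
  else if (i == 1%N :> nat) && (j == 0%N :> nat) then k1
  else if (i == 0%N :> nat) && (j == 1%N :> nat) then k2 else 0) => p.
rewrite fE !big_ord_recl big_ord0 /=.
do 4!rewrite big_mkcond !big_ord_recl big_ord0 /=.
by rewrite /bump /=; ring.
Qed.

Lemma coord_affine_seg f x y (u : R) : coord_affine f ->
  f ((1 - u) *: x + u *: y) = (1 - u) * f x + u * f y.
Proof. by case=> k0 [k1 [k2 fE]]; rewrite !fE !mxE; ring. Qed.

(** An affine function takes at the mean of three points the mean of its values; this is where the
    Greville points come from. *)
Lemma polar_affine_third f x y z : coord_affine f ->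
  polar f x y z = f (3^-1 *: (x + y + z)).
Proof. by case=> k0 [k1 [k2 fE]]; rewrite /polar !fE !mxE; field. Qed.

Lemma coord_affine_C1 (A : set 'rV[R]_2) f : coord_affine f -> C1_on A f.
Proof.
move=> fA; have bf := polar_blossom (coord_affine_cubic fA).
have [k0 [k1 [k2 fE]]] := fA; split.
  apply: continuous_subspaceT; rewrite (funext fE); exact: coord_affine_continuous.
move=> v; exists (fun=> k1 * v 0 0 + k2 * v 0 1).
  by apply: continuous_subspaceT; exact: cst_continuous.
move=> p _.
have -> : k1 * v 0 0 + k2 * v 0 1 = 3 * (polar f p p v - polar f p p 0).
  by rewrite !polar_affine_third // !fE !mxE; field.
exact: blossom_is_derive.
Qed.

End Linearity.

Section Reproduction.
Context {R : realType} {V : finType}.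
Variables (D : mesh R V) (Q : split R V).
Hypotheses (hD : is_triangulation D) (hQ : is_PS D Q).
Variable q : V -> 'I_3 -> 'rV[R]_2.
Hypothesis hq : forall i, is_vertex_triangle D Q i (q i).
Implicit Types (i j k : V) (e t : {set V}) (p : 'rV[R]_2) (S f : 'rV[R]_2 -> R).

Lemma spline_lin S1 S2 (k : R) : spline D Q S1 -> spline D Q S2 ->
  spline D Q (fun p => S1 p + k * S2 p).
Proof.
move=> [C1 P1] [C2 P2]; split; first exact: C1_on_lin.
move=> i j t ijt; have [p1 c1 E1] := P1 _ _ _ ijt; have [p2 c2 E2] := P2 _ _ _ ijt.
exists (fun p => p1 p + k * p2 p); first exact: cubic_lin.
by move=> p hp; rewrite E1 // E2.
Qed.

Lemma micro_blossom_lin S1 S2 (k : R) i j t x y z : is_micro D i j t ->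
  spline D Q S1 -> spline D Q S2 ->
  micro_blossom D Q (fun p => S1 p + k * S2 p) i j t x y z =
  micro_blossom D Q S1 i j t x y z + k * micro_blossom D Q S2 i j t x y z.
Proof.
move=> ijt [_ P1] [_ P2].
have [p1 c1 E1] := P1 _ _ _ ijt; have [p2 c2 E2] := P2 _ _ _ ijt.
have c := cubic_lin k c1 c2.
rewrite (micro_blossom_polar hD hQ ijt c1 E1) (micro_blossom_polar hD hQ ijt c2 E2).
rewrite (micro_blossom_polar hD hQ ijt c) ?polar_lin // => p hp.
by rewrite E1 // E2.
Qed.

Lemma edge_neq i j : [set i; j] \in edges D -> i != j.
Proof. by move/(card_edge hD); rewrite cards2; case: eqP. Qed.

Lemma bedge_edge e : e \in bedges D -> e \in edges D.
Proof. by rewrite inE => /andP[]. Qed.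

Lemma beta_lin S1 S2 (k : R) a : is_dof D a -> spline D Q S1 -> spline D Q S2 ->
  beta D Q q a (fun p => S1 p + k * S2 p) = beta D Q q a S1 + k * beta D Q q a S2.
Proof.
move=> da s1 s2; case: a da => [i r|i j t|i j] /= da.
- by case: pickP => [[j t] /= ijt|_]; [exact: micro_blossom_lin | ring].
- exact: micro_blossom_lin.
- case: pickP => [t ijt|_]; last by ring.
  by apply: micro_blossom_lin => //; rewrite /is_micro ijt edge_neq // bedge_edge.
Qed.

Definition greville (a : dof V) : 'rV[R]_2 :=
  match a with
  | Dv i r => q i r
  | Dt i j t => qek D Q [set i; j] t
  | De i j => qeb D Q [set i; j]
  end.

Lemma coord_affine_spline f : coord_affine f -> spline D Q f.
Proof.
move=> fA; split; first exact: coord_affine_C1.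
by move=> i j t _; exists f => //; exact: coord_affine_cubic.
Qed.

(** Each Greville point is the mean of the blossom arguments. For [Dv] the factor 3 in the last
    argument cancels against the mean and leaves [q i r]. *)
Lemma beta_affine f a : is_dof D a -> coord_affine f ->
  beta D Q q a f = f (greville a).
Proof.
move=> da fA.
have bE i j t x y z : is_micro D i j t ->
    micro_blossom D Q f i j t x y z = f (3^-1 *: (x + y + z)).
  move=> ijt; rewrite (micro_blossom_polar hD hQ ijt (coord_affine_cubic fA)) //.
  exact: polar_affine_third.
case: a da => [i r|i j t|i j] /= da.
- have [j [t [ijt bi]]] := pick_micro Q hD q f i.
  have := bi r; rewrite /= => ->.
  by rewrite bE //; congr f; apply: rv2_eq; rewrite !mxE; field.
- rewrite bE //; congr f; have /andP[ij _] := da.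
  by rewrite /qek sum_pair // -!scalerDr mul1r.
- have ij := edge_neq (bedge_edge da).
  case: pickP => [t tij|none].
    rewrite bE; last by rewrite /is_micro ij.
    by congr f; rewrite /qeb sum_pair // -!scalerDr mul1r.
  have /eqP/cards1P[t tE] := boundary_edge hD da.
  by have := none t; rewrite tE set11.
Qed.

Variable B : dof V -> 'rV[R]_2 -> R.
Hypothesis hB : is_dual_basis D Q q B.

(** A finite type in bijection with [dof], over which sums can run. *)
Definition dof_index : finType := (V * 'I_3 + (V * V * {set V} + V * V))%type.

Definition dof_of (x : dof_index) : dof V :=
  match x with
  | inl (i, r) => Dv i r
  | inr (inl (i, j, t)) => Dt i j t
  | inr (inr (i, j)) => De i j
  end.

Definition index_of (a : dof V) : dof_index :=
  match a with
  | Dv i r => inl (i, r)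
  | Dt i j t => inr (inl (i, j, t))
  | De i j => inr (inr (i, j))
  end.

Lemma dof_ofK : cancel dof_of index_of.
Proof. by move=> [[]|[[[]]|[]]]. Qed.
Lemma index_ofK : cancel index_of dof_of.
Proof. by case. Qed.

(** Induction on the list. The two claims go together because linearity of [beta] is available
    between splines. *)
Lemma spline_sum (c : dof_index -> R) (s : seq dof_index) :
  let S p := \sum_(x <- s | is_dof D (dof_of x)) c x * B (dof_of x) p in
  spline D Q S /\ forall a, is_dof D a -> beta D Q q a S =
    \sum_(x <- s | is_dof D (dof_of x)) c x * beta D Q q a (B (dof_of x)).
Proof.
have [sB _ _] := hB; elim: s => [|x s [sS bS]] /=.
  have f0 : coord_affine (fun=> 0 : R) by exists 0, 0, 0 => p; ring.
  rewrite (_ : (fun _ => _) = (fun=> 0)); last by apply/funext => p; rewrite big_nil.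
  by split; [exact: coord_affine_spline | move=> a da; rewrite beta_affine // big_nil].
case: (boolP (is_dof D (dof_of x))) => dx.
  rewrite (_ : (fun _ => _) = (fun p => \sum_(x <- s | is_dof D (dof_of x))
      c x * B (dof_of x) p + c x * B (dof_of x) p)); last first.
    by apply/funext => p; rewrite big_cons dx addrC.
  split; first by apply: spline_lin => //; exact: sB.
  by move=> a da; rewrite beta_lin ?bS //; [rewrite big_cons dx addrC | exact: sB].
rewrite (_ : (fun _ => _) = (fun p => \sum_(x <- s | is_dof D (dof_of x))
    c x * B (dof_of x) p)); last first.
  by apply/funext => p; rewrite big_cons (negPf dx).
by split=> // a da; rewrite big_cons (negPf dx) bS.
Qed.

(** The difference of both sides is a spline annihilated by every functional, so the cone argument
    with {0} makes it vanish on each triangle. *)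
Lemma affine_reproduction f p : coord_affine f -> Omega D p ->
  f p = \sum_(x : dof_index | is_dof D (dof_of x))
    B (dof_of x) p * f (greville (dof_of x)).
Proof.
move=> fA [t tT ctp]; have [sB B1 B0] := hB.
pose c x := f (greville (dof_of x)).
have [sG bG] := spline_sum c (index_enum dof_index).
move: sG bG; set G := fun p => _ => sG bG.
have sS := spline_lin (-1) (coord_affine_spline fA) sG.
have bS a : is_dof D a -> beta D Q q a (fun p => f p + -1 * G p) = 0.
  move=> da; rewrite beta_lin //; last exact: coord_affine_spline.
  rewrite beta_affine // bG // (bigD1 (index_of a)) /= ?index_ofK // B1 //.
  rewrite big1; first by rewrite /c index_ofK; ring.
  move=> x /andP[dx /eqP xa]; rewrite B0 ?mulr0 // => ax.
  by apply: xa; rewrite ax dof_ofK.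
have : f p + -1 * G p = 0.
  apply: (cone_cell hD hQ hq (K := fun x => x = 0) _ sS tT _ _ _ ctp).
  - by move=> ? ? ? ? _ _ -> ->; rewrite !mulr0 addr0.
  - by move=> i r _; exact: bS.
  - by move=> i j t' _ ijt'; exact: bS.
  - by move=> i j _ ijb; exact: bS.
rewrite mulN1r => /eqP; rewrite subr_eq0 => /eqP ->.
by apply: eq_bigr => x _; rewrite mulrC.
Qed.

(** All functionals that control a spline on [t] are attached to vertices and edges of [t], hence
    differ from [a] and vanish on [B a]. *)
Lemma basis_support a t p : is_dof D a -> t \in tris D ->
  match a with
  | Dv i _ => i \notin t
  | Dt i j _ | De i j => ~~ ([set i; j] \subset t)
  end -> cell D t p -> B a p = 0.
Proof.
move=> da tT loc ctp; have [sB B1 B0] := hB.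
apply: (cone_cell hD hQ hq (K := fun x => x = 0) _ (sB _ da) tT _ _ _ ctp).
- by move=> ? ? ? ? _ _ -> ->; rewrite !mulr0 addr0.
- by move=> i r it; apply: B0 => // ea; move: loc; rewrite -ea it.
- by move=> i j t' ijt ijt'; apply: B0 => // ea; move: loc; rewrite -ea ijt.
- by move=> i j ijt ijb; apply: B0 => // ea; move: loc; rewrite -ea ijt.
Qed.

Lemma basis_ge0 a p : is_dof D a -> Omega D p -> 0 <= B a p.
Proof.
move=> da [t tT ctp]; have [sB B1 B0] := hB.
have b0 a' : is_dof D a' -> 0 <= beta D Q q a' (B a).
  by move=> da'; have [->|ne] := pselect (a' = a); [rewrite B1 | rewrite B0].
apply: (cone_cell hD hQ hq (K := fun x => 0 <= x) _ (sB _ da) tT _ _ _ ctp).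
- by move=> ? ? ? ? *; rewrite addr_ge0 // mulr_ge0.
- by move=> i r _; exact: b0.
- by move=> i j t' _ ijt'; exact: b0.
- by move=> i j _ ijb; exact: b0.
Qed.

End Reproduction.

(** * The reduced set *)

Section Reduced.
Context {R : realType} {V : finType}.
Variables (D : mesh R V) (Q : split R V).
Hypotheses (hD : is_triangulation D) (hQ : is_PS D Q).
Variable q : V -> 'I_3 -> 'rV[R]_2.
Hypothesis hq : forall i, is_vertex_triangle D Q i (q i).
Variable B : dof V -> 'rV[R]_2 -> R.
Hypothesis hB : is_dual_basis D Q q B.
Variable om : {set V} -> {set V} -> R.
Hypothesis hom : is_weights D Q om.
Implicit Types (i j k : V) (e t : {set V}) (p : 'rV[R]_2) (f : 'rV[R]_2 -> R).

Lemma tris_atP e t : reflect (t \in tris D /\ e \subset t) (t \in tris_at D e).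
Proof. by rewrite inE; exact: andP. Qed.

Lemma edge_micro e t (x : V * V) : e \in edges D -> t \in tris_at D e ->
  [set x.1; x.2] == e -> is_micro D x.1 x.2 t.
Proof. by move=> eE te /eqP xe; rewrite /is_micro xe te (edge_neq hD) ?xe. Qed.

Lemma BtE_ge0 e t p : e \in edges D -> t \in tris_at D e -> Omega D p ->
  0 <= BtE B e t p.
Proof.
move=> eE te hp; apply: sumr_ge0 => x xe.
by apply: (basis_ge0 hD hQ hq hB) => //=; exact: edge_micro eE te xe.
Qed.

Lemma BtE_support e t t' p : e \in edges D -> t \in tris_at D e ->
  t' \in tris D -> ~~ (e \subset t') -> cell D t' p -> BtE B e t p = 0.
Proof.
move=> eE te t'T et' hp; apply: big1 => x xe.
apply: (basis_support hD hQ hq hB _ t'T) hp => /=; first exact: edge_micro eE te xe.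
by rewrite (eqP xe).
Qed.

Lemma Bek_support e t t' p : e \in edges D -> t \in tris_at D e ->
  t' \in tris D -> ~~ (e \subset t') -> cell D t' p -> Bek D B om e t p = 0.
Proof.
move=> eE te t'T et' hp; rewrite /Bek (BtE_support eE te t'T et' hp) mulr0 add0r.
by apply: big1 => t'' /andP[te' _]; rewrite (BtE_support eE te' t'T et' hp) mulr0.
Qed.

Lemma edge_tri e t : e \in edges D -> t \in tris_at D e ->
  exists i j k, e = [set i; j] /\ triple D i j k t.
Proof.
move=> eE te; have /eqP/cards2P[i [j [ij eij]]] := card_edge hD eE.
have [k ijk] : exists k, triple D i j k t.
  by apply: (micro_triple hD); rewrite /is_micro ij -eij.
by exists i, j, k.
Qed.

Lemma triple_cons i j k t : triple D i j k t -> t = k |: [set i; j].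
Proof. by case=> _ -> _ _ _; rewrite setUC. Qed.

Lemma bedge_tris e : e \in bedges D -> exists t, tris_at D e = [set t].
Proof. by move=> eB; apply/cards1P; rewrite (boundary_edge hD eB). Qed.

Lemma inner_tris e : e \in edges D -> e \notin bedges D ->
  exists t t', t != t' /\ tris_at D e = [set t; t'].
Proof.
move=> eE eI; have /eqP/cards2P[t [t' [tt' ->]]] := interior_edge hD eE eI.
by exists t, t'.
Qed.

(* The point associated with [Bek e t] in the representation: the barycenter of
   e = {i, j} and [wpt D Q k t], for t = {i, j, k}. *)
Definition qred e t : 'rV[R]_2 :=
  if t \in sym_tris D Q then qt3 D t else qek D Q e t.

Lemma qredE i j k t : triple D i j k t ->
  qred [set i; j] t = 3^-1 *: (vtx D i + vtx D j + wpt D Q k t).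
Proof.
move=> ijk; have [tT tE ij ik jk] := ijk; rewrite /qred /wpt /qt3 /qek.
case: ifP => _; first by rewrite tE sum_triple // -!scalerDr mul1r.
by rewrite sum_pair // -!scalerDr mul1r.
Qed.

Lemma qekE i j k t : triple D i j k t ->
  qek D Q [set i; j] t = 3^-1 *: (vtx D i + vtx D j + tpt Q t).
Proof. by move=> [_ _ ij _ _]; rewrite /qek sum_pair // -!scalerDr mul1r. Qed.

(** Both kinds of points average the edge ends with a third point, so the relation between split
    points given by the weights passes to them. *)
Lemma inner_weight e t t' : e \in edges D -> e \notin bedges D ->
  t \in tris_at D e -> t' \in tris_at D e -> t != t' ->
  0 <= om e t <= 1 /\
  qek D Q e t = (1 - om e t) *: qred e t + om e t *: qred e t'.
Proof.
move=> eE eI te t'e tt'; have [i [j [k [eij ijk]]]] := edge_tri eE te.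
have ij : i != j by case: ijk.
have [k' ijk'] : exists k', triple D i j k' t'.
  by apply: (micro_triple hD); rewrite /is_micro ij -eij.
have [tT _] := tris_atP _ _ te; have [t'T _] := tris_atP _ _ t'e.
have [/(_ i j k k')] := hom; rewrite /= -eij => inner _.
have tE := triple_cons ijk; have t'E := triple_cons ijk'.
rewrite -eij in tE t'E; move: inner; rewrite -tE -t'E => inner.
have [om01 tptE] := inner eE eI tT t'T tt'; split=> //.
rewrite {1 3 5}eij (qekE ijk) (qredE ijk) (qredE ijk') tptE.
by apply: rv2_eq; rewrite !mxE; ring.
Qed.

Lemma boundary_weight e t : e \in bedges D -> t \in tris_at D e ->
  0 <= om e t <= 1 /\
  qek D Q e t = (1 - om e t) *: qred e t + om e t *: qeb D Q e.
Proof.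
move=> eB te; have eE := bedge_edge eB.
have [i [j [k [eij ijk]]]] := edge_tri eE te.
have ij : i != j by case: ijk.
have [tT _] := tris_atP _ _ te.
have [_ /(_ i j k)] := hom; rewrite /= -eij => bound.
have tE := triple_cons ijk; rewrite -eij in tE; move: bound; rewrite -tE => bound.
have [om01 tptE] := bound eB tT; split=> //.
have -> : qeb D Q e = 3^-1 *: (vtx D i + vtx D j + ept Q e).
  by rewrite /qeb {1}eij sum_pair // -!scalerDr mul1r.
rewrite {1 3}eij (qekE ijk) (qredE ijk) tptE.
by apply: rv2_eq; rewrite !mxE; field.
Qed.

Lemma om_range e t : e \in edges D -> t \in tris_at D e -> 0 <= om e t <= 1.
Proof.
move=> eE te; have [eB|eI] := boolP (e \in bedges D).
  by have [] := boundary_weight eB te.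
have [t1 [t2 [t12 tsE]]] := inner_tris eE eI.
have t1e : t1 \in tris_at D e by rewrite tsE !inE eqxx.
have t2e : t2 \in tris_at D e by rewrite tsE !inE eqxx orbT.
move: te; rewrite tsE !inE => /orP[/eqP->|/eqP->].
  by have [] := inner_weight eE eI t1e t2e t12.
by rewrite eq_sym in t12; have [] := inner_weight eE eI t2e t1e t12.
Qed.

Lemma Bek_ge0 e t p : e \in edges D -> t \in tris_at D e -> Omega D p ->
  0 <= Bek D B om e t p.
Proof.
move=> eE te hp; have /andP[_ om1] := om_range eE te; apply: addr_ge0.
  by rewrite mulr_ge0 ?subr_ge0 // BtE_ge0.
apply: sumr_ge0 => t' /andP[t'e _]; have /andP[om0 _] := om_range eE t'e.
by rewrite mulr_ge0 // BtE_ge0.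
Qed.

(** On the left, [BtE B e t] has the coefficient [(1 - om e t) * f (qred e t) + om e t * f (qred e
    t')], with [t'] the other triangle; this is [f (qek D Q e t)] since [f] is affine. *)
Lemma inner_regroup f e p : coord_affine f -> e \in edges D -> e \notin bedges D ->
  \sum_(t in tris_at D e) Bek D B om e t p * f (qred e t) =
  \sum_(t in tris_at D e) BtE B e t p * f (qek D Q e t).
Proof.
move=> fA eE eI; have [t [t' [tt' tsE]]] := inner_tris eE eI.
have te : t \in tris_at D e by rewrite tsE !inE eqxx.
have t'e : t' \in tris_at D e by rewrite tsE !inE eqxx orbT.
have t't : t' != t by rewrite eq_sym.
have [_ qE] := inner_weight eE eI te t'e tt'.
have [_ q'E] := inner_weight eE eI t'e te t't.
have BekE t1 t2 : t1 != t2 -> tris_at D e = [set t1; t2] ->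
    Bek D B om e t1 p = (1 - om e t1) * BtE B e t1 p + om e t2 * BtE B e t2 p.
  move=> t12 E; rewrite /Bek E (big_pred1 t2) // => s.
  rewrite !inE; have [->|] := eqVneq s t1; first by rewrite (negPf t12).
  by rewrite andbT.
rewrite tsE !big_setU1 ?inE //= !big_set1 qE q'E !coord_affine_seg // (BekE t t') //.
by rewrite (BekE t' t) //; [ring | rewrite tsE setUC].
Qed.

(** Same computation, with [Beb] and the edge point in the role of the missing neighbour. *)
Lemma boundary_regroup f e p : coord_affine f -> e \in bedges D ->
  \sum_(t in tris_at D e) Bek D B om e t p * f (qred e t)
    + Beb D B om e p * f (qeb D Q e) =
  \sum_(t in tris_at D e) BtE B e t p * f (qek D Q e t)
    + (\sum_(x : V * V | [set x.1; x.2] == e) B (De x.1 x.2) p) * f (qeb D Q e).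
Proof.
move=> fA eB; have [t tsE] := bedge_tris eB.
have te : t \in tris_at D e by rewrite tsE inE.
have [_ qE] := boundary_weight eB te.
rewrite /Beb /Bek tsE !big_set1 qE coord_affine_seg // big1 ?addr0; first by ring.
by move=> s; rewrite inE => /andP[->].
Qed.

Lemma micro_sum f p :
  \sum_(x : V * V * {set V} | is_micro D x.1.1 x.1.2 x.2)
    B (Dt x.1.1 x.1.2 x.2) p * f (qek D Q [set x.1.1; x.1.2] x.2) =
  \sum_(e in edges D) \sum_(t in tris_at D e) BtE B e t p * f (qek D Q e t).
Proof.
(* The ordered small triangles are grouped by the mesh edge they touch. *)
rewrite (partition_big (fun x : V * V * {set V} => [set x.1.1; x.1.2])
  (mem (edges D))) /=; last by move=> x /(micro_edge hD).
apply: eq_bigr => e eE; rewrite /BtE.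
under [RHS]eq_bigr do rewrite mulr_suml.
rewrite exchange_big pair_big; apply: eq_big => [[[i j] t] /=|[[i j] t] /=].
  have [eij|] := eqVneq [set i; j] e; last by rewrite andbF.
  by rewrite andbT /is_micro (edge_neq hD) eij.
by case/andP=> _ /eqP->.
Qed.

Lemma bedge_sum f p :
  \sum_(x : V * V | [set x.1; x.2] \in bedges D)
    B (De x.1 x.2) p * f (qeb D Q [set x.1; x.2]) =
  \sum_(e in bedges D)
    (\sum_(x : V * V | [set x.1; x.2] == e) B (De x.1 x.2) p) * f (qeb D Q e).
Proof.
rewrite (partition_big (fun x : V * V => [set x.1; x.2]) (mem (bedges D))) //=.
apply: eq_bigr => e eB; rewrite mulr_suml; apply: eq_big => [x|x /andP[_ /eqP->] //].
by have [->|] := eqVneq [set x.1; x.2] e; rewrite ?andbF ?andbT.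
Qed.

(** On a symmetric triangle [qred] is the barycenter for all three edges, so the three edge
    functions share one coefficient and merge into [Bt3]. *)
Lemma sym_sum f p :
  \sum_(t in sym_tris D Q) Bt3 D B om t p * f (qt3 D t)
  + \sum_(e in edges D) \sum_(t in tris_at D e :\: sym_tris D Q)
      Bek D B om e t p * f (qek D Q e t) =
  \sum_(e in edges D) \sum_(t in tris_at D e) Bek D B om e t p * f (qred e t).
Proof.
under eq_bigr do rewrite /Bt3 mulr_suml.
rewrite (exchange_big_dep (mem (edges D))) /=; last by move=> t e _ /andP[].
rewrite -big_split; apply: eq_bigr => e eE /=.
rewrite [RHS](bigID (mem (sym_tris D Q))) /=; congr (_ + _).
  apply: eq_big => [t|t /andP[tS _]]; last by rewrite /qred tS.
  by rewrite eE !inE; case: (t \in tris D); rewrite //= andbC.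
apply: eq_big => [t|t]; first by rewrite inE andbC.
by rewrite inE => /andP[/negPf tS _]; rewrite /qred tS.
Qed.

Lemma reduced_reproduction f p : coord_affine f -> Omega D p ->
  f p = \sum_(i : V) \sum_(r < 3) Bv B i r p * f (q i r)
    + \sum_(t in sym_tris D Q) Bt3 D B om t p * f (qt3 D t)
    + \sum_(e in edges D) \sum_(t in tris_at D e :\: sym_tris D Q)
        Bek D B om e t p * f (qek D Q e t)
    + \sum_(e in bedges D) Beb D B om e p * f (qeb D Q e).
Proof.
move=> fA hp; rewrite (affine_reproduction hD hQ hq hB fA hp).
rewrite big_sumType big_sumType /= -!addrA; congr (_ + _).
  by rewrite pair_big; apply: eq_big => [[]|[]].
rewrite [RHS]addrA sym_sum.
transitivity (\sum_(e in edges D) \sum_(t in tris_at D e) BtE B e t p * f (qek D Q e t)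
  + \sum_(e in bedges D)
    (\sum_(x : V * V | [set x.1; x.2] == e) B (De x.1 x.2) p) * f (qeb D Q e)).
  rewrite -micro_sum -bedge_sum; congr (_ + _).
    by apply: eq_big => [[[]]|[[]]].
  by apply: eq_big => [[]|[]].
(* Boundary and interior edges obey different regrouping identities. *)
have split_edges (F : {set V} -> R) : \sum_(e in edges D) F e =
    \sum_(e in bedges D) F e + \sum_(e in edges D | e \notin bedges D) F e.
  rewrite (bigID (mem (bedges D))) /=; congr (_ + _); apply: eq_bigl => e.
  by rewrite andbC; case: (boolP (e \in bedges D)) => // /bedge_edge ->.
rewrite !split_edges [LHS]addrAC [RHS]addrAC -!big_split /=; congr (_ + _).
  by apply: eq_bigr => e eB; rewrite boundary_regroup.
by apply: eq_bigr => e /andP[eE eI]; rewrite inner_regroup.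
Qed.

End Reduced.

(** * Derivation of the four properties of the reduced set *)

Theorem theorem24 (R : realType) (V : finType)
  (D : mesh R V) (hD : is_triangulation D)
  (Q : split R V) (hQ : is_PS D Q)
  (q : V -> 'I_3 -> 'rV[R]_2) (hq : forall i, is_vertex_triangle D Q i (q i))
  (B : dof V -> 'rV[R]_2 -> R) (hB : is_dual_basis D Q q B)
  (om : {set V} -> {set V} -> R) (hom : is_weights D Q om) :
  (* local support *)
  [/\ forall i r t, t \in tris D -> i \notin t ->
        forall p, cell D t p -> Bv B i r p = 0,
      forall t t', t \in sym_tris D Q -> t' \in tris D -> t' != t ->
        (forall e, e \in edges D -> e \subset t -> ~~ (e \subset t')) ->
        forall p, cell D t' p -> Bt3 D B om t p = 0,
      forall e t t', e \in edges D -> t \in tris_at D e :\: sym_tris D Q ->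
        t' \in tris D -> t' \notin tris_at D e ->
        forall p, cell D t' p -> Bek D B om e t p = 0 &
      forall e t', e \in bedges D -> t' \in tris D -> t' \notin tris_at D e ->
        forall p, cell D t' p -> Beb D B om e p = 0] /\
  (* nonnegativity *)
  (forall p, Omega D p ->
    [/\ forall i r, 0 <= Bv B i r p,
        forall t, t \in sym_tris D Q -> 0 <= Bt3 D B om t p,
        forall e t, e \in edges D -> t \in tris_at D e :\: sym_tris D Q ->
          0 <= Bek D B om e t p &
        forall e, e \in bedges D -> 0 <= Beb D B om e p]) /\
  (* partition of unity *)
  (forall p, Omega D p ->
    \sum_(i : V) \sum_(r < 3) Bv B i r p
    + \sum_(t in sym_tris D Q) Bt3 D B om t p
    + \sum_(e in edges D) \sum_(t in tris_at D e :\: sym_tris D Q)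
        Bek D B om e t p
    + \sum_(e in bedges D) Beb D B om e p = 1) /\
  (* representation of the coordinate functions *)
  (forall p, Omega D p ->
    p = \sum_(i : V) \sum_(r < 3) Bv B i r p *: q i r
        + \sum_(t in sym_tris D Q) Bt3 D B om t p *: qt3 D t
        + \sum_(e in edges D) \sum_(t in tris_at D e :\: sym_tris D Q)
            Bek D B om e t p *: qek D Q e t
        + \sum_(e in bedges D) Beb D B om e p *: qeb D Q e).
Proof.
have in_tris t : t \in sym_tris D Q -> t \in tris D by rewrite inE => /andP[].
have in_at (e t : {set V}) : t \in tris_at D e :\: sym_tris D Q -> t \in tris_at D e.
  by rewrite inE => /andP[].
have at_sub (e t : {set V}) : t \in tris D -> e \subset t -> t \in tris_at D e.
  by move=> tT et; rewrite inE tT.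
have not_at (e t : {set V}) : t \in tris D -> t \notin tris_at D e -> ~~ (e \subset t).
  by rewrite inE => ->.
have repr := reduced_reproduction hD hQ hq hB hom.
split; first split.
- by move=> i r t tT it p; exact: (basis_support hD hQ hq hB (a := Dv i r)).
- move=> t t' tS t'T _ sep p hp; apply: big1 => e /andP[eE et].
  exact: (Bek_support hD hQ hq hB om eE (at_sub _ _ (in_tris _ tS) et) t'T (sep _ eE et) hp).
- move=> e t t' eE te t'T t'e p hp.
  exact: (Bek_support hD hQ hq hB om eE (in_at _ _ te) t'T (not_at _ _ t'T t'e) hp).
- move=> e t' eB t'T /(not_at _ _ t'T) t'e p hp; have eE := bedge_edge eB.
  rewrite /Beb !big1 ?addr0 // => [t te|x /eqP xe].
    by rewrite (BtE_support hD hQ hq hB eE te t'T t'e hp) mulr0.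
  by apply: (basis_support hD hQ hq hB _ t'T) hp => /=; rewrite xe.
split; first (move=> p hp; split).
- by move=> i r; exact: (basis_ge0 hD hQ hq hB (a := Dv i r)).
- move=> t tS; apply: sumr_ge0 => e /andP[eE et].
  exact: (Bek_ge0 hD hQ hq hB hom eE (at_sub _ _ (in_tris _ tS) et) hp).
- by move=> e t eE /in_at te; exact: (Bek_ge0 hD hQ hq hB hom eE te hp).
- move=> e eB; have eE := bedge_edge eB; apply: addr_ge0; apply: sumr_ge0.
    by move=> x /eqP xe; apply: (basis_ge0 hD hQ hq hB) => //=; rewrite xe.
  move=> t te; have /andP[om0 _] := om_range hD hom eE te.
  by rewrite mulr_ge0 // (BtE_ge0 hD hQ hq hB eE te hp).
split=> p hp.
  (* Partition of unity is the reproduction of the constant 1. *)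
  have one : coord_affine (fun=> 1 : R) by exists 1, 0, 0 => x; ring.
  rewrite [RHS](repr _ p one hp); congr (_ + _ + _ + _).
  - by apply: eq_bigr => i _; apply: eq_bigr => r _; rewrite mulr1.
  - by apply: eq_bigr => t _; rewrite mulr1.
  - by apply: eq_bigr => e _; apply: eq_bigr => t _; rewrite mulr1.
  - by apply: eq_bigr => e _; rewrite mulr1.
(* The vector identity is checked per coordinate, each coordinate being an affine function. *)
have coord (n : 'I_2) : coord_affine (fun x : 'rV[R]_2 => x 0 n) ->
    p 0 n = (\sum_(i : V) \sum_(r < 3) Bv B i r p *: q i r
        + \sum_(t in sym_tris D Q) Bt3 D B om t p *: qt3 D t
        + \sum_(e in edges D) \sum_(t in tris_at D e :\: sym_tris D Q)
            Bek D B om e t p *: qek D Q e t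
        + \sum_(e in bedges D) Beb D B om e p *: qeb D Q e) 0 n.
  move=> cA; rewrite [LHS](repr _ p cA hp) !mxE !summxE; congr (_ + _ + _ + _).
  - apply: eq_bigr => i _; rewrite summxE; apply: eq_bigr => r _; by rewrite [RHS]mxE.
  - by apply: eq_bigr => t _; rewrite [RHS]mxE.
  - apply: eq_bigr => e _; rewrite summxE; apply: eq_bigr => t _; by rewrite [RHS]mxE.
  - by apply: eq_bigr => e _; rewrite [RHS]mxE.
apply: rv2_eq; apply: coord.
  by exists 0, 1, 0 => x; ring.
by exists 0, 0, 1 => x; ring.
Qed.
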